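(* Let $\mathfrak A$ be an Arens regular Banach algebra which is an ideal in $\mathfrak A^{\ast\ast}$. Then the following are equivalent: (i) $\mathfrak A$ is amenable. (ii) $\mathfrak A^{\ast\ast}$ is Connes-amenable.
   Context: A Banach algebra $\mathfrak B$ is called dual if there is a closed submodule $\mathfrak B_\ast$ of the Banach $\mathfrak B$-bimodule $\mathfrak B^\ast$ such that $\mathfrak B = (\mathfrak B_\ast)^\ast$; the $w^\ast$-topology on $\mathfrak B$ is $\sigma(\mathfrak B,\mathfrak B_\ast)$. A Banach algebra $\mathfrak A$ is Arens regular if the two Arens products on $\mathfrak A^{\ast\ast}$ coincide; then $\mathfrak A^{\ast\ast}$ with this product is a dual Banach algebra with predual $\mathfrak A^\ast$, and $\mathfrak A$ is regarded as a subalgebra of $\mathfrak A^{\ast\ast}$ via the canonical embedding. A derivation from a Banach algebra $\mathfrak A$ into a Banach $\mathfrak A$-bimodule $E$ is a bounded linear map $D$ with $D(ab) = a\cdot Db + (Da)\cdot b$; it is inner if it is of the form $a \mapsto a\cdot x - x\cdot a$ for some $x \in E$. The dual $E^\ast$ of a Banach $\mathfrak A$-bimodule is a Banach $\mathfrak A$-bimodule via $\langle x, a\cdot\phi\rangle = \langle x\cdot a,\phi\rangle$, $\langle x,\phi\cdot a\rangle = \langle a\cdot x,\phi\rangle$. $\mathfrak A$ is amenable if, for every Banach $\mathfrak A$-bimodule $E$, every derivation $\mathfrak A \to E^\ast$ is inner. If $\mathfrak B$ is a dual Banach algebra and $E$ a Banach $\mathfrak B$-bimodule, then $E^\ast$ is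 a $w^\ast$-Banach $\mathfrak B$-bimodule if for each $\phi\in E^\ast$ the maps $\mathfrak B \to E^\ast$, $b\mapsto b\cdot\phi$ and $b\mapsto\phi\cdot b$, are $w^\ast$-continuous (i.e. $\sigma(\mathfrak B,\mathfrak B_\ast)$-$\sigma(E^\ast,E)$-continuous). $\mathfrak B$ is Connes-amenable if, for every $w^\ast$-Banach $\mathfrak B$-bimodule $E^\ast$, every $w^\ast$-continuous derivation $\mathfrak B\to E^\ast$ is inner. *)

(* Defs.v *)
From HB Require Import structures.
From mathcomp Require Import all_boot all_order all_algebra.
From mathcomp Require Import all_classical all_reals all_analysis.
From mathcomp Require Import complex ring.

Set Implicit Arguments.
Unset Strict Implicit.
Unset Printing Implicit Defensive.

Import Order.TTheory GRing.Theory Num.Theory.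
Import numFieldNormedType.Exports.

Local Open Scope classical_set_scope.
Local Open Scope ring_scope.
Local Open Scope complex_scope.

Section complex_complete.
Variable R : realType.

Lemma normc_le_ReIm (x : R[i]) :
  `|x| <= `|complex.Re x|%:C + `|complex.Im x|%:C.
Proof.
rewrite [x in X in X <= _]complexE (le_trans (ler_normD _ _))//.
rewrite normrM.
have -> : `|'i%C : R[i]| = 1 by rewrite normc_def/= expr0n/= expr1n add0r sqrtr1.
by rewrite mul1r !normc_def /= !expr0n /= !addr0 !sqrtr_sqr.
Qed.

Lemma complex_complete (F : set_system (R[i])^o) :
  ProperFilter F -> cauchy F -> cvg F.
Proof.
move=> FF /cauchyP Fc.
have part_cvg (p : (R[i])^o -> R) :
    (forall x y, `|p x - p y|%:C <= `|x - y|) -> cvg (p @ F).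
  move=> ple; apply: cauchy_cvg; apply: cauchy_exP => e e0.
  have e0' : 0 < e%:C by rewrite ltcR.
  have [x Fx] := Fc _ e0'; exists (p x).
  suff : F [set y | `|p x - p y| < e] by [].
  apply: filterS Fx => y /= xy.
  rewrite -ltcR.
  by apply: le_lt_trans (ple _ _) _; exact: xy.
have Re_c : cvg ((@complex.Re R : (R[i])^o -> R) @ F).
  by apply: part_cvg => x y; rewrite -raddfB; exact: normc_ge_Re.
have Im_c : cvg ((@complex.Im R : (R[i])^o -> R) @ F).
  apply: part_cvg => x y; rewrite -raddfB.
  have := normc_ge_Re ((x - y) * 'i%C).
  rewrite normrM ReiNIm normrN.
  by rewrite [`|'i%C|]normc_def /= expr0n expr1n add0r sqrtr1 mulr1.
apply/cvg_ex.
exists (lim ((@complex.Re R : (R[i])^o -> R) @ F) +i*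
        lim ((@complex.Im R : (R[i])^o -> R) @ F))%C.
apply/cvgrPdist_le => e e0.
have [r eE] : exists r, e = r%:C by apply/complex_realP; exact: gtr0_real.
rewrite eE ltcR in e0 *; have r20 : 0 < r / 2 by exact: divr_gt0.
near=> x; apply: le_trans (normc_le_ReIm _) _.
rewrite !raddfB /= -rmorphD lecR [leRHS]splitr lerD//.
  near: x; move/cvgrPdist_le : Re_c; exact.
near: x; move/cvgrPdist_le : Im_c; exact.
Unshelve. all: by end_near. Qed.
End complex_complete.

Section dual.
Variables (R : realType) (E : normedModType R[i]).

Definition continuous_functional : {pred (E -> (R[i])^o)} :=
  [pred f : E -> (R[i])^o | `[< linear f /\ continuous f >]].

(* The codomain is the regular module (R[i])^o, on which *: is *. *)
Record dual := Dual {
  dual_fun :> E -> (R[i])^o ;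
  _ : dual_fun \in continuous_functional }.

HB.instance Definition _ := [isSub for dual_fun].
HB.instance Definition _ := [Choice of dual by <:].

Lemma continuous_functional_submod : submod_closed continuous_functional.
Proof.
split.
  apply/asboolP; split; last by move=> x; apply: cvg_cst.
  move=> k x y; transitivity (k * 0 + 0 : R[i]).
    rewrite mulr0 addr0; reflexivity.
  reflexivity.
move=> a f g /asboolP[lf cf] /asboolP[lg cg]; apply/asboolP; split.
  move=> k x y; rewrite -[LHS]/(a * f (k *: x + y) + g (k *: x + y)).
  rewrite -[RHS]/(k * (a * f x + g x) + (a * f y + g y)) lf lg.
  rewrite -[k *: f x]/(k * f x) -[k *: g x]/(k * g x); ring.
move=> x; apply: (@cvgD _ _ _ _ _ (a \*: f) g); last exact: cg.
by apply: cvgZr; exact: cf.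
Qed.

HB.instance Definition _ := GRing.isSubmodClosed.Build _ _ continuous_functional
  continuous_functional_submod.
HB.instance Definition _ := [SubChoice_isSubLmodule of dual by <:].

Implicit Types f g : dual.

Lemma dual_linear f : linear f.
Proof. by case: f => f /=; case/asboolP. Qed.

HB.instance Definition _ f :=
  GRing.isLinear.Build R[i] E (R[i])^o *:%R f (dual_linear f).

Lemma dual_continuous f : continuous f.
Proof. by case: f => f /=; case/asboolP. Qed.

Lemma dualP f g : (forall x, f x = g x) -> f = g.
Proof. by move=> fg; apply/val_inj/funext. Qed.

Lemma dual0E x : (0 : dual) x = 0. Proof. by []. Qed.
Lemma dualDE f g x : (f + g) x = f x + g x. Proof. by []. Qed.
Lemma dualNE f x : (- f) x = - f x. Proof. by []. Qed.
Lemma dualZE (a : R[i]) f x : (a *: f) x = a * f x. Proof. by []. Qed.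
Definition dualE := (dual0E, dualDE, dualNE, dualZE).

Lemma dual_bounded f : exists2 M : R, 0 <= M & forall x, `|f x| <= M%:C * `|x|.
Proof.
have /linear_boundedP/pinfty_ex_gt0[M M0 fM] :=
  (linear_bounded_continuous f).2 (@dual_continuous f).
have /complex_realP[r Mr] := gtr0_real M0.
by exists r; [rewrite Mr ltcR in M0; exact: ltW|rewrite -Mr].
Qed.

Definition dual_norm f : R :=
  sup [set complex.Re `|f x| | x in [set x | `|x| <= 1]].

Lemma norm_Re (z : R[i]) : `|z| = (complex.Re `|z|)%:C.
Proof. by rewrite normc_def. Qed.

Let ball_nonempty f :
  [set complex.Re `|f x| | x in [set x | `|x| <= 1]] !=set0.
Proof. by exists (complex.Re `|f 0|); exists 0; rewrite //= normr0. Qed.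

Let norm_has_sup f :
  has_sup [set complex.Re `|f x| | x in [set x | `|x| <= 1]].
Proof.
split; first exact: ball_nonempty.
have [M M0 fM] := dual_bounded f; exists M => _ [x /= x1 <-].
rewrite -lecR -norm_Re (le_trans (fM _))// -[leRHS]mulr1.
by rewrite ler_wpM2l// ler0c.
Qed.

Lemma dual_norm_ge0 f : 0 <= dual_norm f.
Proof.
apply: le_trans (sup_upper_bound (norm_has_sup f) _); last first.
  by exists 0; rewrite //= normr0.
by rewrite -ler0c -norm_Re.
Qed.

Lemma le_dual_norm f x : `|f x| <= (dual_norm f)%:C * `|x|.
Proof.
have [->|x0] := eqVneq x 0; first by rewrite linear0 !normr0 mulr0.
have nx : 0 < `|x| by rewrite normr_gt0.
rewrite -ler_pdivrMr// mulrC -[X in X * _]ger0_norm ?invr_ge0// -normrM.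
rewrite -[X in `|X|]/(`|x|^-1 *: f x) -linearZ norm_Re lecR.
apply: (sup_upper_bound (norm_has_sup f)).
exists (`|x|^-1 *: x) => //=.
by rewrite normrZ ger0_norm ?invr_ge0// mulVf// gt_eqF.
Qed.

Lemma dual_norm_le f (M : R) : 0 <= M ->
  (forall x, `|f x| <= M%:C * `|x|) -> dual_norm f <= M.
Proof.
move=> M0 fM; apply: ge_sup; first exact: ball_nonempty.
move=> _ [x /= x1 <-]; rewrite -lecR -norm_Re (le_trans (fM _))//.
by rewrite -[leRHS]mulr1 ler_wpM2l// ler0c.
Qed.

Let dual_normD f g :
  (dual_norm (f + g))%:C <= (dual_norm f)%:C + (dual_norm g)%:C.
Proof.
rewrite -rmorphD lecR; apply: dual_norm_le.
  by rewrite addr_ge0 ?dual_norm_ge0.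
move=> x; rewrite rmorphD mulrDl (le_trans (ler_normD _ _))//.
by rewrite lerD ?le_dual_norm.
Qed.

Let dual_normZ_le (a : R[i]) f :
  (dual_norm (a *: f))%:C <= `|a| * (dual_norm f)%:C.
Proof.
rewrite [`|a|]norm_Re -rmorphM lecR; apply: dual_norm_le.
  by rewrite mulr_ge0 ?dual_norm_ge0// -ler0c -norm_Re.
move=> x; rewrite dualZE normrM rmorphM /= -norm_Re -mulrA ler_wpM2l//.
exact: le_dual_norm.
Qed.

Let dual_normZ (a : R[i]) f :
  (dual_norm (a *: f))%:C = `|a| * (dual_norm f)%:C.
Proof.
apply/eqP; rewrite eq_le dual_normZ_le /=.
have [->|a0] := eqVneq a 0.
  by rewrite normr0 mul0r ler0c dual_norm_ge0.
rewrite -ler_pdivlMl ?normr_gt0// -normfV.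
by rewrite -{1}[f](@scalerK _ _ a) ?unitfE// dual_normZ_le.
Qed.

Let dual_norm0 f : (dual_norm f)%:C = 0 -> f = 0.
Proof.
move=> f0; apply: dualP => x; apply/eqP; rewrite -normr_le0.
by rewrite (le_trans (le_dual_norm _ _))// f0 mul0r.
Qed.

HB.instance Definition _ := Lmodule_isNormed.Build R[i] dual
  dual_normD dual_normZ dual_norm0.

Lemma dual_normE f : `|f| = (dual_norm f)%:C. Proof. by []. Qed.

Lemma dual_opnorm f x : `|f x| <= `|f| * `|x|.
Proof. exact: le_dual_norm. Qed.

Lemma dual_opnorm_le f (M : R[i]) : 0 <= M ->
  (forall x, `|f x| <= M * `|x|) -> `|f| <= M.
Proof.
move=> M0; have /complex_realP[r Mr] := ger0_real M0.
rewrite Mr in M0 * => fM.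
by rewrite dual_normE lecR; apply: dual_norm_le; rewrite // -ler0c.
Qed.

Fact mk_dual_subproof (f : E -> (R[i])^o) : linear f ->
  (exists2 M : R[i], 0 <= M & forall x, `|f x| <= M * `|x|) ->
  f \in continuous_functional.
Proof.
move=> lf [M M0 fM]; apply/asboolP; split=> //.
pose F : {linear E -> (R[i])^o} := HB.pack f (GRing.isLinear.Build _ _ _ _ f lf).
apply/(@linear_bounded_continuous _ _ _ F)/linear_boundedP.
exists M; split; first exact: ger0_real.
by move=> r Mr x; rewrite (le_trans (fM _))// ler_wpM2r// ltW.
Qed.

Definition mk_dual (h : E -> (R[i])^o) lh bh : dual :=
  Dual (@mk_dual_subproof h lh bh).

Lemma dual_complete (F : set_system dual) : ProperFilter F -> cauchy F -> cvg F.
Proof.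
move=> FF Fc.
have Fe (e : R[i]) : 0 < e -> exists g, F [set f | `|g - f| < e].
  move=> e0; have /cauchyP/(_ _ e0)[g Fg] := Fc.
  by exists g; rewrite -ball_normE in Fg.
have cv x : cvg ((fun f => f x : (R[i])^o) @ F).
  apply: complex_complete; apply: cauchy_exP => e e0.
  have d0 : 0 < e / (`|x| + 1) by rewrite divr_gt0// ltr_wpDl.
  have [g Fg] := Fe _ d0; exists (g x).
  suff : F [set f | `|g x - f x| < e] by [].
  apply: filterS Fg => f /= gf.
  rewrite -[g x - f x]/((g - f) x) (le_lt_trans (dual_opnorm _ _))//.
  rewrite (@le_lt_trans _ _ (`|g - f| * (`|x| + 1)))//.
    by rewrite ler_wpM2l// lerDl.
  by rewrite -ltr_pdivlMr// ltr_wpDl.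
pose L x : (R[i])^o := lim ((fun f => f x : (R[i])^o) @ F).
have LP x : (fun f => f x : (R[i])^o) @ F --> L x by exact: cv.
have Llin : linear L.
  move=> a x y; apply: cvg_lim; first exact: norm_hausdorff.
  under eq_fun do rewrite linearP.
  by apply: cvgD; [apply: cvgZr; exact: LP|exact: LP].
have Lnear (e : R[i]) : 0 < e -> exists2 g : dual,
    F [set f | `|g - f| < e] & forall x, `|g x - L x| <= e * `|x|.
  move=> e0; have [g Fg] := Fe _ e0; exists g => // x.
  apply/ler_addgt0Pr => d d0; near F => f.
  rewrite -[g x](subrK (f x)) -addrA (le_trans (ler_normD _ _))//.
  rewrite lerD//.
    rewrite -[g x - f x]/((g - f) x) (le_trans (dual_opnorm _ _))//.
    by rewrite ler_wpM2r// ltW//; near: f.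
  by rewrite distrC; near: f; move/cvgrPdist_le : (LP x); exact.
have [g1 _ g1L] := Lnear 1 ltr01.
have Lb : exists2 M : R[i], 0 <= M & forall x, `|L x| <= M * `|x|.
  exists (`|g1| + 1) => [|x]; first by rewrite addr_ge0.
  rewrite -[L x](subrK (g1 x)) (le_trans (ler_normD _ _))//.
  by rewrite distrC mulrDl addrC lerD// dual_opnorm.
pose Ld := mk_dual Llin Lb.
apply/cvg_ex; exists Ld; apply/cvgrPdist_lt => e e0.
have e20 : 0 < e / 2 by rewrite divr_gt0.
have [g Fg gL] := Lnear _ e20.
near=> f; rewrite -[Ld](subrK g) -addrA (le_lt_trans (ler_normD _ _))//.
rewrite [ltRHS]splitr ler_ltD//; last by near: f.
rewrite distrC; apply: dual_opnorm_le; first exact: ltW.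
exact: gL.
Unshelve. all: by end_near. Qed.

HB.instance Definition _ := Uniform_isComplete.Build dual dual_complete.

End dual.

(* Banach algebras need not be unital. *)
HB.mixin Record isBanachAlgebra (R : realType) A
    & CompleteNormedModule R[i] A := {
  amul : A -> A -> A ;
  amulA : associative amul ;
  amul_linearl : forall b, linear (amul^~ b) ;
  amul_linearr : forall a, linear (amul a) ;
  amul_norm : forall a b, `|amul a b| <= `|a| * `|b| }.

#[short(type="banachAlgType")]
HB.structure Definition BanachAlgebra (R : realType) :=
  {A of CompleteNormedModule R[i] A & isBanachAlgebra R A}.

Section bimodule.
Variables (R : realType) (A : banachAlgType R).

Record banachBimodule := BanachBimodule {
  bimod_sort :> completeNormedModType R[i] ;
  lact : A -> bimod_sort -> bimod_sort ;
  ract : bimod_sort -> A -> bimod_sort ;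
  lact_linearl : forall x, linear (lact^~ x) ;
  lact_linearr : forall a, linear (lact a) ;
  ract_linearl : forall a, linear (ract^~ a) ;
  ract_linearr : forall x, linear (ract x) ;
  lactM : forall a b x, lact (amul a b) x = lact a (lact b x) ;
  ractM : forall x a b, ract x (amul a b) = ract (ract x a) b ;
  lractA : forall a x b, ract (lact a x) b = lact a (ract x b) ;
  act_bounded : exists2 K : R[i], 0 <= K & forall a x,
    `|lact a x| <= K * (`|a| * `|x|) /\ `|ract x a| <= K * (`|x| * `|a|) }.

Definition regular_bimodule : banachBimodule.
Proof.
refine (@BanachBimodule A amul amul _ _ _ _ _ _ _ _).
- exact: amul_linearl.
- exact: amul_linearr.
- exact: amul_linearl.
- exact: amul_linearr.
- by move=> a b x; rewrite amulA.
- by move=> a b x; rewrite amulA.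
- by move=> a b x; rewrite amulA.
- by exists 1 => // a x; rewrite !mul1r; split; exact: amul_norm.
Defined.

(* <x, a.f> = <x.a, f> and <x, f.a> = <a.x, f> *)
Section dual_bimodule.
Variable E : banachBimodule.

Fact dual_lact_linear (a : A) (f : dual E) :
  linear ((fun x => f (ract x a)) : E -> (R[i])^o).
Proof. by move=> k x y; rewrite ract_linearl linearP. Qed.

Fact dual_lact_bounded (a : A) (f : dual E) :
  exists2 M : R[i], 0 <= M & forall x, `|f (ract x a)| <= M * `|x|.
Proof.
have [K K0 Kb] := act_bounded E; exists (`|f| * (K * `|a|)) => [|x].
  by rewrite !mulr_ge0.
rewrite (le_trans (dual_opnorm _ _))// -mulrA ler_wpM2l//.
by rewrite -mulrA [`|a| * _]mulrC; exact: (Kb a x).2.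
Qed.

Definition dual_lact (a : A) (f : dual E) : dual E :=
  mk_dual (dual_lact_linear a f) (dual_lact_bounded a f).

Fact dual_ract_linear (f : dual E) (a : A) :
  linear ((fun x => f (lact a x)) : E -> (R[i])^o).
Proof. by move=> k x y; rewrite lact_linearr linearP. Qed.

Fact dual_ract_bounded (f : dual E) (a : A) :
  exists2 M : R[i], 0 <= M & forall x, `|f (lact a x)| <= M * `|x|.
Proof.
have [K K0 Kb] := act_bounded E; exists (`|f| * (K * `|a|)) => [|x].
  by rewrite !mulr_ge0.
rewrite (le_trans (dual_opnorm _ _))// -mulrA ler_wpM2l//.
by rewrite -mulrA; exact: (Kb a x).1.
Qed.

Definition dual_ract (f : dual E) (a : A) : dual E :=
  mk_dual (dual_ract_linear f a) (dual_ract_bounded f a).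

Fact dual_act_bounded : exists2 K : R[i], 0 <= K & forall a f,
  `|dual_lact a f| <= K * (`|a| * `|f|) /\
  `|dual_ract f a| <= K * (`|f| * `|a|).
Proof.
have [K K0 Kb] := act_bounded E; exists K => // a f.
split; apply: dual_opnorm_le => [|x]; rewrite ?mulr_ge0//=.
- rewrite (le_trans (dual_opnorm _ _))//.
  rewrite (_ : _ * `|x| = `|f| * (K * (`|x| * `|a|))); last by ring.
  by rewrite ler_wpM2l//; exact: (Kb a x).2.
- rewrite (le_trans (dual_opnorm _ _))//.
  rewrite (_ : _ * `|x| = `|f| * (K * (`|a| * `|x|))); last by ring.
  by rewrite ler_wpM2l//; exact: (Kb a x).1.
Qed.

Definition dual_bimodule : banachBimodule.
Proof.
refine (@BanachBimodule (dual E) dual_lact dual_ract _ _ _ _ _ _ _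
  dual_act_bounded).
- by move=> f k a b; apply: dualP => x; rewrite /= ract_linearr linearP.
- by move=> a k f g; apply: dualP.
- by move=> a k f g; apply: dualP.
- by move=> f k a b; apply: dualP => x; rewrite /= lact_linearl linearP.
- by move=> a b f; apply: dualP => x; rewrite /= ractM.
- by move=> f a b; apply: dualP => x; rewrite /= lactM.
- by move=> a f b; apply: dualP => x; rewrite /= lractA.
Defined.

End dual_bimodule.

Definition derivation (M : banachBimodule) (D : A -> M) : Prop :=
  [/\ linear D, continuous D &
      forall a b, D (amul a b) = lact a (D b) + ract (D a) b].

Definition inner (M : banachBimodule) (D : A -> M) : Prop :=
  exists x : M, forall a, D a = lact a x - ract x a.

Definition amenable : Prop :=
  forall (E : banachBimodule) (D : A -> dual_bimodule E),
    derivation D -> inner D.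

Definition ideal (I : set A) : Prop :=
  [/\ I 0, forall (k : R[i]) x y, I x -> I y -> I (k *: x + y) &
      forall a x, I x -> I (amul a x) /\ I (amul x a)].

End bimodule.

Section canonical_embedding.
Variables (R : realType) (E : normedModType R[i]).

Fact canonical_linear (x : E) :
  linear ((fun f : dual E => f x) : dual E -> (R[i])^o).
Proof. by []. Qed.

Fact canonical_bounded (x : E) :
  exists2 M : R[i], 0 <= M & forall f : dual E, `|f x| <= M * `|f|.
Proof. by exists `|x| => // f; rewrite [leRHS]mulrC; exact: dual_opnorm. Qed.

Definition canonical (x : E) : dual (dual E) :=
  mk_dual (canonical_linear x) (canonical_bounded x).

Lemma canonical_is_linear : linear canonical.
Proof. by move=> k x y; apply: dualP => f; rewrite /= linearP. Qed.

Lemma canonical_norm_le (x : E) : `|canonical x| <= `|x|.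
Proof. by apply: dual_opnorm_le => // f; rewrite [leRHS]mulrC; exact: dual_opnorm. Qed.

End canonical_embedding.

Section arens.
Variables (R : realType) (A : banachAlgType R).
Let A1 : banachBimodule A := dual_bimodule (regular_bimodule A).
Implicit Types (F G : dual (dual A)) (f : dual A) (a : A).

Let lactE a f x : (lact a (f : A1) : dual A) x = f (amul x a).
Proof. by []. Qed.
Let ractE a f x : (ract (f : A1) a : dual A) x = f (amul a x).
Proof. by []. Qed.

Let lact_norm a f : `|(lact a (f : A1) : dual A)| <= `|a| * `|f|.
Proof.
apply: dual_opnorm_le => [|x]; first by rewrite mulr_ge0.
rewrite lactE (le_trans (dual_opnorm _ _))//.
rewrite (_ : _ * `|x| = `|f| * (`|x| * `|a|)); last by ring.
by rewrite ler_wpM2l// amul_norm.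
Qed.

Let ract_norm a f : `|(ract (f : A1) a : dual A)| <= `|f| * `|a|.
Proof.
apply: dual_opnorm_le => [|x]; first by rewrite mulr_ge0.
by rewrite ractE (le_trans (dual_opnorm _ _))// -mulrA ler_wpM2l// amul_norm.
Qed.

Fact bidual_lact_linear F f :
  linear ((fun a => F (ract (f : A1) a)) : A -> (R[i])^o).
Proof. by move=> k a b; rewrite ract_linearr linearP. Qed.

Fact bidual_lact_bounded F f :
  exists2 M : R[i], 0 <= M & forall a, `|F (ract (f : A1) a)| <= M * `|a|.
Proof.
exists (`|F| * `|f|) => [|a]; first by rewrite mulr_ge0.
by rewrite (le_trans (dual_opnorm _ _))// -mulrA ler_wpM2l// ract_norm.
Qed.

(* <a, F.f> = <f.a, F> *)
Definition bidual_lact F f : dual A :=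
  mk_dual (bidual_lact_linear F f) (bidual_lact_bounded F f).

Fact bidual_ract_linear f F :
  linear ((fun a => F (lact a (f : A1))) : A -> (R[i])^o).
Proof. by move=> k a b; rewrite lact_linearl linearP. Qed.

Fact bidual_ract_bounded f F :
  exists2 M : R[i], 0 <= M & forall a, `|F (lact a (f : A1))| <= M * `|a|.
Proof.
exists (`|F| * `|f|) => [|a]; first by rewrite mulr_ge0.
rewrite (le_trans (dual_opnorm _ _))// -mulrA ler_wpM2l//.
by rewrite [leRHS]mulrC; exact: lact_norm.
Qed.

(* <a, f.F> = <a.f, F> *)
Definition bidual_ract f F : dual A :=
  mk_dual (bidual_ract_linear f F) (bidual_ract_bounded f F).

Lemma bidual_lact_norm F f : `|bidual_lact F f| <= `|F| * `|f|.
Proof.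
apply: dual_opnorm_le => [|a]; first by rewrite mulr_ge0.
by rewrite (le_trans (dual_opnorm F _))// -mulrA ler_wpM2l// ract_norm.
Qed.

Lemma bidual_ract_norm f F : `|bidual_ract f F| <= `|F| * `|f|.
Proof.
apply: dual_opnorm_le => [|a]; first by rewrite mulr_ge0.
rewrite (le_trans (dual_opnorm F _))// -mulrA ler_wpM2l//.
by rewrite [leRHS]mulrC; exact: lact_norm.
Qed.

Lemma bidual_lactP F : linear (bidual_lact F).
Proof.
move=> k f g; apply: dualP => a.
transitivity (F (k *: (ract (f : A1) a : dual A) + (ract (g : A1) a : dual A))).
  by congr (F _); apply: dualP.
exact: dual_linear.
Qed.

Lemma bidual_ractP F : linear (bidual_ract^~ F).
Proof.
move=> k f g; apply: dualP => a.
transitivity (F (k *: (lact a (f : A1) : dual A) + (lact a (g : A1) : dual A))).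
  by congr (F _); apply: dualP.
exact: dual_linear.
Qed.

Fact arens1_linear F G :
  linear ((fun f => F (bidual_lact G f)) : dual A -> (R[i])^o).
Proof. by move=> k f g; rewrite bidual_lactP linearP. Qed.

Fact arens1_bounded F G :
  exists2 M : R[i], 0 <= M & forall f, `|F (bidual_lact G f)| <= M * `|f|.
Proof.
exists (`|F| * `|G|) => [|f]; first by rewrite mulr_ge0.
by rewrite (le_trans (dual_opnorm _ _))// -mulrA ler_wpM2l// bidual_lact_norm.
Qed.

(* First Arens product: <f, FG> = <G.f, F> *)
Definition arens1 F G : dual (dual A) :=
  mk_dual (arens1_linear F G) (arens1_bounded F G).

Fact arens2_linear F G :
  linear ((fun f => G (bidual_ract f F)) : dual A -> (R[i])^o).
Proof. by move=> k f g; rewrite bidual_ractP linearP. Qed.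

Fact arens2_bounded F G :
  exists2 M : R[i], 0 <= M & forall f, `|G (bidual_ract f F)| <= M * `|f|.
Proof.
exists (`|G| * `|F|) => [|f]; first by rewrite mulr_ge0.
by rewrite (le_trans (dual_opnorm _ _))// -mulrA ler_wpM2l// bidual_ract_norm.
Qed.

(* Second Arens product: <f, FG> = <f.F, G> *)
Definition arens2 F G : dual (dual A) :=
  mk_dual (arens2_linear F G) (arens2_bounded F G).

Definition arens_regular : Prop := forall F G, arens1 F G = arens2 F G.

(* The first Arens product makes the bidual a Banach algebra even without
   Arens regularity. *)
Definition bidual : Type := dual (dual A).
HB.instance Definition _ := CompleteNormedModule.on bidual.

Fact arens1A : associative (arens1 : bidual -> bidual -> bidual).
Proof.
move=> F G H; apply: dualP => f /=; congr (F _); apply: dualP => a /=.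
by congr (G _); apply: dualP => b /=; congr (H _); apply: dualP => c /=;
  rewrite amulA.
Qed.

Fact arens1_linearl (G : bidual) :
  linear ((fun F => arens1 F G) : bidual -> bidual).
Proof. by move=> k F F'; apply: dualP. Qed.

Fact arens1_linearr (F : bidual) : linear (arens1 F : bidual -> bidual).
Proof.
move=> k G G'; apply: dualP => f.
transitivity (F (k *: bidual_lact G f + bidual_lact G' f)).
  by congr (F _); apply: dualP.
exact: dual_linear.
Qed.

Fact arens1_norm (F G : bidual) : `|(arens1 F G : bidual)| <= `|F| * `|G|.
Proof.
apply: dual_opnorm_le => [|f]; first by rewrite mulr_ge0.
by rewrite (le_trans (dual_opnorm F _))// -mulrA ler_wpM2l// bidual_lact_norm.
Qed.

HB.instance Definition _ := isBanachAlgebra.Build R bidual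
  arens1A arens1_linearl arens1_linearr arens1_norm.

Definition bidual_embed (a : A) : bidual := canonical a.

Lemma bidual_embedM (a b : A) :
  bidual_embed (amul a b) = amul (bidual_embed a) (bidual_embed b).
Proof. by apply: dualP. Qed.

End arens.

Section dual_banach_algebra.
Variable R : realType.

(* The last two fields say that the canonical map from B to the dual of the
   predual is an isometric isomorphism; the inequality opposite to
   [predual_norm] holds in general. *)
Record dualBanachAlgebra := DualBanachAlgebra {
  dba_sort :> banachAlgType R ;
  predual : set (dual dba_sort) ;
  predual0 : predual 0 ;
  predualP : forall (k : R[i]) f g,
    predual f -> predual g -> predual (k *: f + g) ;
  predual_closed : closed predual ;
  predual_lact : forall b (f : dual_bimodule (regular_bimodule dba_sort)),
    predual f -> predual (lact b f) ;
  predual_ract : forall b (f : dual_bimodule (regular_bimodule dba_sort)),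
    predual f -> predual (ract f b) ;
  predual_norm : forall (b : dba_sort) (M : R[i]), 0 <= M ->
    (forall f, predual f -> `|f b| <= M * `|f|) -> `|b| <= M ;
  predual_surj : forall phi : dual dba_sort -> R[i],
    (forall (k : R[i]) f g, predual f -> predual g ->
      phi (k *: f + g) = k * phi f + phi g) ->
    (exists2 M : R[i], 0 <= M & forall f, predual f -> `|phi f| <= M * `|f|) ->
    exists b : dba_sort, forall f, predual f -> phi f = f b }.

Section connes.
Variable B : dualBanachAlgebra.

(* wstar carries sigma(B, predual): the coarsest topology for which evaluation
   at each predual element is continuous. *)
Definition predual_eval (b : B) :
    {ptws {f : dual B | predual f} -> (R[i])^o} :=
  fun f => sval f b.

Definition wstar : Type := initial_topology predual_eval.
HB.instance Definition _ := Topological.on wstar.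

(* wstar_dual E carries sigma(dual E, E). *)
Definition dual_eval (E : normedModType R[i]) (f : dual E) :
    {ptws E -> (R[i])^o} := f.

Definition wstar_dual (E : normedModType R[i]) : Type :=
  initial_topology (@dual_eval E).
HB.instance Definition _ E := Topological.on (wstar_dual E).

Definition wstar_continuous (E : normedModType R[i]) (T : B -> dual E) : Prop :=
  continuous (T : wstar -> wstar_dual E).

Definition wstar_bimodule (E : banachBimodule B) : Prop :=
  forall f : dual_bimodule E,
    wstar_continuous (fun b => lact b f) /\ wstar_continuous (ract f).

Definition connes_amenable : Prop :=
  forall E : banachBimodule B, wstar_bimodule E ->
  forall D : B -> dual_bimodule E,
    derivation D -> wstar_continuous D -> inner D.

End connes.
End dual_banach_algebra.

Section bidual_dual_banach_algebra.
Variables (R : realType) (A : banachAlgType R) (hA : arens_regular A).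
Let J (f : dual A) : dual (bidual A) := canonical f.

Let J_norm f : `|f| <= `|J f|.
Proof.
apply: dual_opnorm_le => // a.
rewrite -[f a]/(J f (canonical a)) (le_trans (dual_opnorm (J f) _))//.
by rewrite ler_wpM2l// canonical_norm_le.
Qed.

Let J_linear : linear J. Proof. exact: canonical_is_linear. Qed.

Fact bidual_predual_closed : closed (range J).
Proof.
move=> G clG.
have rlin : linear ((fun a => G (canonical a)) : A -> (R[i])^o).
  by move=> k a b; rewrite canonical_is_linear; exact: dual_linear.
have rbd : exists2 M : R[i], 0 <= M &
    forall a : A, `|G (canonical a)| <= M * `|a|.
  exists `|G| => // a; rewrite (le_trans (dual_opnorm G _))//.
  by rewrite ler_wpM2l// canonical_norm_le.
pose f : dual A := mk_dual rlin rbd.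
exists f => //; apply: dualP => F; apply/eqP; rewrite -subr_eq0 -normr_le0.
apply/ler_addgt0Pr => e e0; rewrite add0r.
have d0 : 0 < e / (`|F| + `|F| + 1) by rewrite divr_gt0// ltr_wpDl// addr_ge0.
set d := e / _ in d0.
have [_ [[g _ <-] Gg]] := clG _ (nbhsx_ballx G d d0).
rewrite -ball_normE /= in Gg.
have fg : `|f - g| <= d.
  apply: dual_opnorm_le => [|a]; first exact: ltW.
  rewrite -[(f - g) a]/((G - J g) (canonical a)).
  rewrite (le_trans (dual_opnorm (G - J g) _))// ler_pM// ?canonical_norm_le//.
  exact: ltW.
have -> : J f F - G F = F (f - g) - (G - J g) F.
  have -> : F (f - g) = F f - F g by exact: linearB.
  rewrite -[J f F]/(F f) -[(G - J g) F]/(G F - F g); ring.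
rewrite (le_trans (ler_normB _ _))//.
apply: (@le_trans _ _ (d * (`|F| + `|F| + 1))); last first.
  by rewrite /d divfK// gt_eqF// ltr_wpDl// addr_ge0.
rewrite mulrDr mulr1 ler_wpDr//; first exact: ltW.
rewrite mulrDr lerD//.
  by rewrite (le_trans (dual_opnorm F _))// mulrC ler_wpM2r.
rewrite (le_trans (dual_opnorm (G - J g) _))// ler_wpM2r//.
exact: ltW.
Qed.

(* Arens regularity is what makes the image of dual A stable under the right
   action of the bidual. *)
Definition bidual_dual_banach_algebra : dualBanachAlgebra R.
Proof.
refine (@DualBanachAlgebra R (bidual A) (range J) _ _ bidual_predual_closed
  _ _ _ _).
- by exists 0 => //; apply: dualP => F; exact: (linear0 F).
- by move=> k _ _ [f _ <-] [g _ <-]; exists (k *: f + g) => //; exact: J_linear.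
- move=> F _ [f _ <-]; exists (bidual_lact F f) => //.
  by apply: dualP.
- move=> F _ [f _ <-]; exists (bidual_ract f F) => //.
  by apply: dualP => G; rewrite [RHS]/(arens1 F G f) hA.
- move=> F M M0 FM; apply: dual_opnorm_le => // f.
  apply: le_trans (FM (J f) _) _; first by exists f.
  by rewrite ler_wpM2l//; exact: canonical_norm_le.
- move=> phi philin [M M0 phiM].
  have lin : linear ((fun f => phi (J f)) : dual A -> (R[i])^o).
    by move=> k f g; rewrite J_linear philin.
  have bd : exists2 M : R[i], 0 <= M &
      forall f : dual A, `|phi (J f)| <= M * `|f|.
    exists M => // f; apply: le_trans (phiM (J f) _) _; first by exists f.
    by rewrite ler_wpM2l//; exact: canonical_norm_le.
  by exists (mk_dual lin bd : dual (dual A)) => _ [f _ <-].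
Defined.

End bidual_dual_banach_algebra.

(* Main.v *)
From HB Require Import structures.
From mathcomp Require Import all_boot all_order all_algebra.
From mathcomp Require Import all_classical all_reals all_analysis.
From mathcomp Require Import complex ring lra.
Require Import Defs.

(** If [A] is amenable, a w*-continuous derivation [D] of [A**] is inner on [A];
    the difference between [D] and that inner derivation is w*-continuous and
    vanishes on the w*-dense subalgebra [A].

    Conversely, Connes-amenability gives [A**] an identity [e]. Let [D] be a
    derivation of [A] into [E*] and [X] the closed span of [A.E.A]. Since [A] is
    an ideal, [X] is an [A**]-module: [F.x] is the point of [X] with
    [<F.x, f> = F (a |-> <a.x, f>)] for all [f]. The formula
    [<x, D' F> = F (a |-> <x, D a>)] extends [D] to a w*-continuous derivation
    [D'] of [A**] into [X*], hence [D] agrees on [X] with an inner derivation.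
    What is left is a derivation annihilating [X], which the identity [e]
    shows to be inner. All limits along bounded approximate identities are
    thereby replaced by evaluations of elements of [A**]. *)

Set Implicit Arguments.
Unset Strict Implicit.
Unset Printing Implicit Defensive.

Import Order.TTheory GRing.Theory Num.Theory.
Import numFieldNormedType.Exports.

Local Open Scope classical_set_scope.
Local Open Scope ring_scope.
Local Open Scope complex_scope.

(** * The Hahn-Banach theorem *)

Section sublinear.
Variables (R : realType) (E : lmodType R[i]).
Implicit Types (p q : E -> R) (x y : E).

(** Homogeneity is only an inequality, which is easier to check for infima; applied to [t^-1] as
    well it becomes the equality [sublinearZ]. *)
Definition sublinear q :=
  (forall x y, q (x + y) <= q x + q y) /\
  (forall (t : R) x, 0 < t -> q (t%:C *: x) <= t * q x).

Lemma sublinear0 q : sublinear q -> q 0 = 0.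
Proof.
move=> [qD qZ]; have := qD 0 0; have := qZ (2^-1) 0.
rewrite scaler0 addr0 invr_gt0 => /(_ ltac:(by [])); lra.
Qed.

Lemma sublinearN q x : sublinear q -> - q (- x) <= q x.
Proof.
move=> sq; have [qD _] := sq; have := qD x (- x).
by rewrite subrr (sublinear0 sq); lra.
Qed.

Lemma sublinearZ q (t : R) x : sublinear q -> 0 <= t -> q (t%:C *: x) = t * q x.
Proof.
move=> sq; have [qD qZ] := sq.
rewrite le_eqVlt => /predU1P[<-|t0]; first by rewrite scale0r mul0r sublinear0.
apply/eqP; rewrite eq_le qZ//= -ler_pdivlMl//.
have tV0 : 0 < t^-1 by rewrite invr_gt0.
have := qZ _ (t%:C *: x) tV0.
by rewrite scalerA -rmorphM mulVf ?gt_eqF// scale1r.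
Qed.

(* The bound [l] only serves to make the infima finite. *)
Lemma sublinear_inf (I : Type) (F : I -> E -> R) (l : E -> R) :
  (exists i : I, True) -> (forall i x, l x <= F i x) ->
  (forall i j x y, exists k, F k (x + y) <= F i x + F j y) ->
  (forall i (t : R) x, 0 < t -> exists k, F k (t%:C *: x) <= t * F i x) ->
  let q x := inf [set F i x | i in setT] in
  sublinear q /\ forall i x, q x <= F i x.
Proof.
move=> [i0 _] lF FD FZ q.
have qle i x : q x <= F i x.
  by apply: ge_inf; [exists (l x) => _ [j _ <-]|exists i].
have lbq x (r : R) : (forall i, r <= F i x) -> r <= q x.
  by move=> h; apply: lb_le_inf; [exists (F i0 x), i0|move=> _ [i _ <-]].
split=> //; split=> [x y|t x t0].
  rewrite -lerBlDr; apply: (lbq) => i; rewrite lerBlDr -lerBlDl.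
  apply: (lbq) => j; rewrite lerBlDl.
  by have [k] := FD i j x y; apply: le_trans.
rewrite -ler_pdivrMl//; apply: (lbq) => i; rewrite ler_pdivrMl//.
by have [k] := FZ i t x t0; apply: le_trans.
Qed.

Lemma sublinear_minimal p : sublinear p -> exists q,
  [/\ sublinear q, forall x, q x <= p x &
      forall r, sublinear r -> (forall x, r x <= q x) -> r = q].
Proof.
move=> sp; pose T := {q | sublinear q /\ forall x, q x <= p x}.
(* The order is reversed, so that Zorn's maximal element is a minimal functional and a chain is
   bounded by its infimum. *)
pose le (q r : T) := `[< forall x, sval r x <= sval q x >].
have [||||[q [sq qp]] qmin] := @Zorn T le.
- by move=> q; apply/asboolP.
- move=> q r s /asboolP qr /asboolP rs; apply/asboolP => x.
  exact: le_trans (rs x) (qr x).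
- move=> [q hq] [r hr] /asboolP /= qr /asboolP /= rq; apply: eq_exist.
  by apply/funext => x; apply/eqP; rewrite eq_le qr rq.
- move=> C Ctot; have [C0|/set0P[c0 Cc0]] := eqVneq C set0.
    by exists (exist _ p (conj sp (fun=> lexx _))) => s; rewrite C0.
  pose I := {q : T | C q}.
  (* The infimum of the chain is finite because [- p (- x) <= - q (- x) <= q x] for every sublinear
     [q <= p]. *)
  have := @sublinear_inf I (fun i => sval (sval i)) (fun x => - p (- x)).
  case=> [|[[q [sq qp]] Cq] x /=|||sq qle].
  + by exists (exist _ _ Cc0).
  + by rewrite (le_trans _ (sublinearN _ sq))// lerN2.
  + move=> [q Cq] [r Cr] x y /=; have [/asboolP qr|/asboolP rq] := Ctot _ _ Cq Cr.
      exists (exist _ _ Cr) => /=; have [[rD _] _] := svalP r.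
      by rewrite (le_trans (rD x y))// lerD2r.
    exists (exist _ _ Cq) => /=; have [[qD _] _] := svalP q.
    by rewrite (le_trans (qD x y))// lerD2l.
  + by move=> [[q [[qD qZ] qp]] Cq] t x t0; exists (exist _ _ Cq); exact: (qZ).
  set q := fun _ => _ in sq qle.
  have qp x : q x <= p x.
    apply: le_trans (qle (exist _ _ Cc0) x) _ => /=.
    by have [_ +] := svalP c0; exact.
  exists (exist _ q (conj sq qp)) => s Cs; apply/asboolP => x /=.
  exact: (qle (exist _ s Cs)).
exists q; split=> // r sr rq.
have rp x : r x <= p x by exact: le_trans (rq x) (qp x).
pose r' : T := exist _ r (conj sr rp).
by rewrite -[r]/(sval r') (qmin r')//; apply/asboolP.
Qed.

(* If [q] is minimal, it equals its minorant
   [x |-> inf_(t >= 0) q (x + t y) - t q y], so [q x <= q (x + y) - q y]. *)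
Lemma sublinear_minimal_additive q : sublinear q ->
  (forall r, sublinear r -> (forall x, r x <= q x) -> r = q) ->
  forall x y, q (x + y) = q x + q y.
Proof.
move=> sq qmin x y; have [qD qZ] := sq; apply/eqP; rewrite eq_le qD/=.
pose F (t : {t : R | 0 <= t}) x := q (x + (sval t)%:C *: y) - sval t * q y.
have := @sublinear_inf _ F (fun x => - q (- x)); case.
- by exists (exist _ 0 (lexx _)).
(* Since [t * q y] is [q (t y)], the lower bound is subadditivity for [z + t y] and [- z]. *)
- move=> [t t0] z; rewrite /F/= -(sublinearZ _ sq t0).
  have := qD (z + t%:C *: y) (- z); rewrite addrAC subrr add0r; lra.
- move=> [s s0] [t t0] z w; exists (exist _ (s + t) (addr_ge0 s0 t0)).
  rewrite /F/= rmorphD/= scalerDl addrACA.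
  by have := qD (z + s%:C *: y) (w + t%:C *: y); lra.
- move=> [s s0] t z t0; exists (exist _ (t * s) (mulr_ge0 (ltW t0) s0)).
  rewrite /F/= rmorphM/= -scalerA -scalerDr.
  by have := qZ t (z + s%:C *: y) t0; lra.
move=> sr rF; have := rF (exist _ 1 ler01) x; rewrite /F/= scale1r mul1r.
set r := fun _ => _ in sr *.
have rq : r = q.
  apply: qmin => // z; have := rF (exist _ 0 (lexx _)) z.
  by rewrite /F/= scale0r addr0 mul0r subr0.
by rewrite -[inf _]/(r x) rq; lra.
Qed.
End sublinear.

Section dual_morphism.
Variables (R : realType) (E : normedModType R[i]) (f : dual E).

Lemma dual_app0 : f 0 = 0. Proof. exact: linear0. Qed.
Lemma dual_appD x y : f (x + y) = f x + f y. Proof. exact: linearD. Qed.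
Lemma dual_appZ (k : R[i]) x : f (k *: x) = k * f x.
Proof. exact: linearZ_LR. Qed.

End dual_morphism.

Section hahn_banach.
Variables (R : realType) (E : normedModType R[i]).

Lemma norm_ReE (V : normedModType R[i]) (x : V) : `|x| = (complex.Re `|x|)%:C.
Proof. by have /complex_realP[r ->] := normr_real x. Qed.

Lemma le_Re_norm (z : R[i]) : complex.Re z <= complex.Re `|z|.
Proof.
by rewrite -lecR -norm_Re (le_trans _ (normc_ge_Re _))// lecR ler_norm.
Qed.

(* The starting point is [p x = inf_y M |x - j y| + Re (psi y)]; a minimal
   sublinear [u <= p] is the real part of the extension. *)
Lemma hahn_banach (Y : lmodType R[i]) (j : {linear Y -> E})
    (psi : {linear Y -> (R[i])^o}) (M : R) : 0 <= M ->
  (forall y, `|psi y| <= M%:C * `|j y|) ->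
  exists phi : dual E, (forall x, `|phi x| <= M%:C * `|x|) /\
    forall y, phi (j y) = psi y.
Proof.
move=> M0 psiM; pose nR (x : E) := complex.Re `|x|.
have nRE x : `|x| = (nR x)%:C by exact: norm_ReE.
have nRD x y : nR (x + y) <= nR x + nR y.
  by rewrite -lecR rmorphD/= -!nRE ler_normD.
have nRZ (t : R) x : 0 < t -> nR (t%:C *: x) = t * nR x.
  move=> t0; apply/(@complexI R); rewrite rmorphM/= -!nRE normrZ ger0_norm//.
  by rewrite ler0c ltW.
have nRN x : nR (- x) = nR x by rewrite /nR normrN.
pose F y x := M * nR (x - j y) + complex.Re (psi y).
have psi_ge y : - (M * nR (j y)) <= complex.Re (psi y).
  rewrite lerNl -raddfN (le_trans (le_Re_norm _))// normrN -lecR -norm_Re.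
  by rewrite rmorphM/= -nRE.
have := @sublinear_inf _ _ _ F (fun x => - (M * nR x)); case.
- by exists 0.
- move=> y x; rewrite /F.
  have : nR (j y) <= nR (x - j y) + nR x.
    by rewrite -(nRN (x - _)) opprB; have := nRD (j y - x) x; rewrite subrK.
  by move=> /(ler_wpM2l M0); have := psi_ge y; lra.
- move=> y z v w; exists (y + z); rewrite /F (linearD j) (linearD psi).
  rewrite opprD addrACA raddfD.
  by have := ler_wpM2l M0 (nRD (v - j y) (w - j z)); lra.
- move=> y t x t0; exists (t%:C *: y); rewrite /F (linearZ_LR j) (linearZ_LR psi).
  rewrite -scalerBr nRZ//.
  have -> : complex.Re (t%:C *: psi y) = t * complex.Re (psi y).
    by case: (psi y) => a b /=; rewrite mul0r subr0.
  lra.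
move=> sp pF; have [u [su up umin]] := sublinear_minimal sp.
have uD := sublinear_minimal_additive su umin.
have u0 := sublinear0 su.
have uN x : u (- x) = - u x by have := uD x (- x); rewrite subrr u0; lra.
have uZ (t : R) x : u (t%:C *: x) = t * u x.
  have [t0|t0] := leP 0 t; first exact: sublinearZ.
  rewrite -[t]opprK rmorphN/= scaleNr uN sublinearZ ?oppr_ge0 1?ltW//.
  by rewrite !mulNr.
have uM x : u x <= M * nR x.
  apply: le_trans (up x) _; apply: le_trans (pF 0 x) _.
  by rewrite /F (linear0 j) (linear0 psi) subr0 addr0.
(* The term of index [y] in the infimum gives one inequality; the other is the same inequality at
   [- y], as [u] is odd. *)
have uj y : u (j y) = complex.Re (psi y).
  have h z : u (j z) <= complex.Re (psi z).
    apply: le_trans (up _) _; apply: le_trans (pF z _) _.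
    by rewrite /F subrr /nR normr0 mulr0 add0r.
  have := h y; have := h (- y).
  by rewrite (linearN j) (linearN psi) uN raddfN; lra.
(* The complex functional with real part [u] must be [u x - i u (i x)]. *)
pose f x : (R[i])^o := (u x +i* - u ('i%C *: x))%C.
have fl : linear f.
  move=> k x y; rewrite /f.
  have iD : 'i%C *: (k *: x + y) = k *: ('i%C *: x) + 'i%C *: y.
    by rewrite scalerDr !scalerA mulrC.
  have kE v : u (k *: v) = complex.Re k * u v + complex.Im k * u ('i%C *: v).
    by rewrite {1}[k]complexE ['i%C * _]mulrC scalerDl uD uZ -scalerA uZ.
  rewrite iD !uD !kE scalerA -expr2 sqr_i scaleN1r uN.
  case: k {iD kE} => a b /=; apply/eqP; rewrite eq_complex/=; apply/andP.
  by split; apply/eqP; ring.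
have fj y : f (j y) = psi y.
  rewrite /f -linearZ !uj linearZ/=; case: (psi y) => a b /=.
  by apply/eqP; rewrite eq_complex/= eqxx/=; apply/eqP; ring.
have fM x : `|f x| <= M%:C * `|x|.
  have [->|fx0] := eqVneq (f x) 0; first by rewrite normr0 mulr_ge0 ?ler0c.
  (* Rotating [x] by the unimodular [k] makes the value of [f] real and nonnegative, so it equals
     [u (k x)], which [uM] bounds. *)
  pose k : R[i] := `|f x| / f x.
  have k1 : `|k| = 1 by rewrite normrM normfV normr_id divff ?normr_eq0.
  have : f (k *: x) = `|f x|.
    have := fl k x 0; rewrite addr0 => ->.
    have -> : f 0 = 0 by rewrite /f scaler0 u0 oppr0.
    by rewrite addr0 /k -[LHS]/(`|f x| / f x * f x) divfK.
  move=> /(congr1 (@complex.Re R)); rewrite -[LHS]/(u (k *: x)) => ukx.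
  rewrite norm_Re -ukx nRE -rmorphM lecR (le_trans (uM _))//.
  by rewrite /nR normrZ k1 mul1r.
have fb : exists2 M : R[i], 0 <= M & forall x, `|f x| <= M * `|x|.
  by exists M%:C => //; rewrite ler0c.
by exists (mk_dual fl fb); split=> //.
Qed.

(** Extends [k x |-> k |x|] from the multiples of [x]. As [hahn_banach] allows a map [j] that is not
    injective, [x = 0] is no special case. *)
Lemma norming_functional (x : E) :
  exists phi : dual E, `|phi| <= 1 /\ phi x = `|x|.
Proof.
have jl : linear (fun k : (R[i])^o => k *: x).
  by move=> a b c; rewrite scalerDl scalerA.
have pl : linear (fun k : (R[i])^o => k * `|x| : (R[i])^o).
  by move=> a b c; rewrite mulrDl scalerAl.
pose j : {linear (R[i])^o -> E} := HB.pack (fun k : (R[i])^o => k *: x)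
  (GRing.isLinear.Build _ _ _ _ _ jl).
pose p : {linear (R[i])^o -> (R[i])^o} :=
  HB.pack (fun k : (R[i])^o => k * `|x| : (R[i])^o)
  (GRing.isLinear.Build _ _ _ _ _ pl).
have [y|phi [phiM phiE]] := @hahn_banach _ j p 1 ler01.
  rewrite mul1r -[j y]/((y : R[i]) *: x) [leRHS]normrZ.
  by rewrite -[p y]/((y : R[i]) *: (`|x| : (R[i])^o)) [leLHS]normrZ normr_id.
exists phi; split.
  by apply: dual_opnorm_le => // y; rewrite -[1]/(1%:C); exact: phiM.
have := phiE (1 : R[i]); rewrite -[p _]/((1 : R[i]) * `|x|).
rewrite -[j _]/((1 : R[i]) *: x).
by rewrite scale1r mul1r.
Qed.

Lemma canonical_norm (x : E) : `|canonical x| = `|x|.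
Proof.
apply/eqP; rewrite eq_le canonical_norm_le/=.
have [phi [phi1 phix]] := norming_functional x.
rewrite -[`|x|]normr_id -phix -[phi x]/(canonical x phi).
by rewrite (le_trans (dual_opnorm _ _))// ler_piMr.
Qed.

Lemma canonical_inj : injective (@canonical R E).
Proof.
move=> x y xy; apply/eqP; rewrite -subr_eq0 -normr_eq0 -canonical_norm.
have -> : canonical (x - y) = canonical x - canonical y.
  by rewrite addrC -scaleN1r canonical_is_linear scaleN1r addrC.
by rewrite xy subrr normr0.
Qed.

Lemma dual_sep (x y : E) : (forall f : dual E, f x = f y) -> x = y.
Proof. by move=> xy; apply: canonical_inj; apply: dualP => f; exact: xy. Qed.

End hahn_banach.

(** * Closed submodules *)

Section closed_submodule.
Variables (R : realType) (V : completeNormedModType R[i]).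

(** Bundled so that one can intersect over all of them, as [ess_set] does, and regard each as the
    Banach space [csub]. *)
Record closed_submodule := ClosedSubmodule {
  csub_set : set V ;
  csub_closed : closed csub_set ;
  csub0 : csub_set 0 ;
  csubP : forall (k : R[i]) x y, csub_set x -> csub_set y ->
    csub_set (k *: x + y) }.

Variable Y : closed_submodule.

Definition csub_pred : {pred V} := [pred x | `[< csub_set Y x >]].

Record csub := CSub { csub_val :> V ; _ : csub_val \in csub_pred }.

HB.instance Definition _ := [isSub for csub_val].
HB.instance Definition _ := [Choice of csub by <:].

Lemma csub_pred_submod : submod_closed csub_pred.
Proof.
split; first by apply/asboolP; exact: csub0.
by move=> k x y /asboolP Yx /asboolP Yy; apply/asboolP; exact: csubP.
Qed.

HB.instance Definition _ := GRing.isSubmodClosed.Build _ _ csub_pred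
  csub_pred_submod.
HB.instance Definition _ := [SubChoice_isSubLmodule of csub by <:].

Lemma csub_valP (x : csub) : csub_set Y x.
Proof. by case: x => x /= /asboolP. Qed.

Definition mk_csub (x : V) (Yx : csub_set Y x) : csub := CSub (asboolT Yx).

Lemma csub_val_inj : injective csub_val.
Proof. exact: val_inj. Qed.

Let csub_normD (x y : csub) : `|csub_val (x + y)| <= `|csub_val x| + `|csub_val y|.
Proof. exact: ler_normD. Qed.

Let csub_normZ (k : R[i]) (x : csub) : `|csub_val (k *: x)| = `|k| * `|csub_val x|.
Proof. exact: normrZ. Qed.

Let csub_norm0 (x : csub) : `|csub_val x| = 0 -> x = 0.
Proof. by move=> /eqP; rewrite normr_eq0 => /eqP x0; exact: val_inj. Qed.

HB.instance Definition _ := Lmodule_isNormed.Build R[i] csub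
  csub_normD csub_normZ csub_norm0.

Lemma csub_norm (x : csub) : `|x| = `|csub_val x|. Proof. by []. Qed.

Lemma csub_complete (F : set_system csub) : ProperFilter F -> cauchy F -> cvg F.
Proof.
move=> FF Fc.
have /cvg_ex[/= v Fv] : cvg (csub_val @ F).
  apply: cauchy_cvg; apply: cauchy_exP => e e0.
  have /cauchyP/(_ _ e0)[g Fg] := Fc.
  exists (csub_val g); rewrite -ball_normE in Fg.
  by suff : F [set f | `|csub_val g - csub_val f| < e] by rewrite -ball_normE.
have Yv : csub_set Y v.
  apply: (@closed_cvg _ _ F FF csub_val (csub_set Y) (@csub_closed Y)) Fv.
  by apply: nearW => x; exact: csub_valP.
apply/cvg_ex; exists (mk_csub Yv); apply/cvgrPdist_lt => e e0.
by move/cvgrPdist_lt : Fv => /(_ _ e0); apply: filterS => x.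
Qed.

HB.instance Definition _ := Uniform_isComplete.Build csub csub_complete.

Lemma csub_val_linear : linear csub_val. Proof. by []. Qed.

HB.instance Definition _ :=
  GRing.isLinear.Build R[i] csub V *:%R csub_val csub_val_linear.

Fact csub_restrict_linear (f : dual V) :
  linear (fun x : csub => f (csub_val x) : (R[i])^o).
Proof. by move=> k x y; exact: (dual_linear f k (csub_val x)). Qed.

Fact csub_restrict_bounded (f : dual V) :
  exists2 M : R[i], 0 <= M & forall x : csub, `|f (csub_val x)| <= M * `|x|.
Proof. by exists `|f| => // x; exact: dual_opnorm. Qed.

Definition csub_restrict (f : dual V) : dual csub :=
  mk_dual (csub_restrict_linear f) (csub_restrict_bounded f).

(** Hahn-Banach for the inclusion. Functionals on the essential part of a module are thus handled
    through functionals on the whole module. *)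
Lemma csub_extend (g : dual csub) : exists f : dual V, csub_restrict f = g.
Proof.
have [|x|f [_ fg]] := @hahn_banach _ _ _ csub_val g (dual_norm g).
- exact: dual_norm_ge0.
- exact: dual_opnorm.
by exists f; apply: dualP => x; exact: fg.
Qed.

Lemma csub_sep (x y : csub) :
  (forall f : dual V, f (csub_val x) = f (csub_val y)) -> x = y.
Proof. by move=> xy; apply: csub_val_inj; exact: dual_sep. Qed.

End closed_submodule.

(* As [U] is complete and [canonical] isometric, limits in the bidual of
   canonical images of points of [Y] are again such images. *)
Lemma closed_canonical_preimage (R : realType) (U W : completeNormedModType R[i])
    (Y : set U) (L : W -> dual (dual U)) (K : R[i]) :
  closed Y -> linear L -> 0 <= K -> (forall x, `|L x| <= K * `|x|) ->
  closed [set x | exists2 u, Y u & canonical u = L x].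
Proof.
move=> clY Ll K0 LK x clx; set S := [set _ | _] in clx.
have LB v w : L (v - w) = L v - L w.
  by rewrite addrC -scaleN1r Ll scaleN1r addrC.
have canB (v w : U) : canonical (v - w) = canonical v - canonical w.
  by rewrite addrC -scaleN1r canonical_is_linear scaleN1r addrC.
(* [u] inverts [canonical] along [L] on [S]; its value 0 elsewhere is irrelevant, because all limits
   are taken within [S]. *)
have /choice[u uP] w : exists u, S w -> Y u /\ canonical u = L w.
  have [[v Yv vL]|nS] := pselect (S w); first by exists v.
  by exists 0.
have Spf : ProperFilter (within S (nbhs x)) by exact: within_nbhs_proper.
(* [K] may be 0, so [K + 1] serves as the divisor in the estimates. *)
have K1 : 0 < K + 1 by rewrite ltr_wpDl.
have uB v w : S v -> S w -> `|u v - u w| <= K * `|v - w|.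
  move=> /uP[_ uv] /uP[_ uw].
  by rewrite -canonical_norm canB uv uw -LB; exact: LK.
have near_x (d : R[i]) : 0 < d -> within S (nbhs x) [set w | S w /\ `|x - w| < d].
  move=> d0; have h : nbhs x [set w | `|x - w| < d].
    by have := nbhsx_ballx x d d0; rewrite -ball_normE.
  by apply: filterS h => w xw Sw; split.
have /cvg_ex[/= v uv] : cvg (u @ within S (nbhs x)).
  apply: cauchy_cvg; apply: cauchy_exP => e e0.
  have d0 : 0 < e / (K + 1) / 2 by rewrite !divr_gt0.
  have [w [Sw xw]] := filter_ex (near_x _ d0); exists (u w).
  rewrite -ball_normE /=.
  apply: filterS (near_x _ d0) => z [Sz xz] /=.
  apply: le_lt_trans (uB _ _ Sw Sz) _.
  apply: (@le_lt_trans _ _ ((K + 1) * `|w - z|)).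
    by rewrite ler_wpM2r// lerDl.
  rewrite -ltr_pdivlMl// mulrC [ltRHS]splitr.
  by rewrite (le_lt_trans (ler_distD x w z))// ltrD// distrC.
exists v.
  apply: (@closed_cvg _ _ _ Spf u Y clY) uv.
  by apply: filterS (near_x _ ltr01) => w [/uP[]].
apply/eqP; rewrite -subr_eq0 -normr_le0; apply/ler_addgt0Pr => e e0; rewrite add0r.
have e20 : 0 < e / 2 by rewrite divr_gt0.
have d0 : 0 < e / 2 / (K + 1) by rewrite divr_gt0.
have Fve : within S (nbhs x) [set w | `|v - u w| < e / 2].
  by move/cvgrPdist_lt : uv => /(_ _ e20).
have [w [vw [Sw xw]]] := filter_ex (filterI Fve (near_x _ d0)).
have -> : canonical v - L x = canonical (v - u w) - L (x - w).
  by rewrite canB LB (uP w Sw).2 opprB addrA subrK.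
rewrite [e]splitr (le_trans (ler_normB _ _))// lerD//.
  by rewrite canonical_norm ltW.
rewrite (le_trans (LK _))// (@le_trans _ _ ((K + 1) * `|x - w|))//.
  by rewrite ler_wpM2r// lerDl.
by rewrite -ler_pdivlMl// mulrC ltW.
Qed.

(** * The w*-topology *)

Lemma mem_span_of_kernels (K : fieldType) (V : lmodType K)
    (P : set (V -> K)) (fs : seq (V -> K)) (f : V -> K) :
  P (fun=> 0) -> (forall k g h, P g -> P h -> P (fun v => k * g v + h v)) ->
  (forall g, List.In g fs -> P g) ->
  (forall g, g = f \/ List.In g fs ->
    forall k u v, g (k *: u + v) = k * g u + g v) ->
  (forall v, (forall g, List.In g fs -> g v = 0) -> f v = 0) -> P f.
Proof.
move=> P0 PD; elim: fs f => [|g fs IH] f Pfs lin ker.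
  suff -> : f = fun=> 0 by [].
  by apply/funext => v; exact: ker.
have linf := lin f (or_introl erefl).
have ling := lin g (or_intror (or_introl erefl)).
have linfs h : List.In h fs -> forall k u v, h (k *: u + v) = k * h u + h v.
  by move=> hfs; apply: lin; right; right.
have Pg := Pfs g (or_introl erefl).
have Pfs' h : List.In h fs -> P h by move=> hfs; apply: Pfs; right.
have [[a [a0 ga]]|na] := pselect
    (exists a, (forall h, List.In h fs -> h a = 0) /\ g a <> 0); last first.
  apply: IH => // [h []|v v0]; [by move=> ->|exact: linfs|].
  apply: ker => h [<-|]; last exact: v0.
  by apply: contrapT => gv; apply: na; exists v.
pose c := f a / g a.
pose f' v := - c * g v + f v.
have -> : f = fun v => c * g v + f' v.
  by apply/funext => v; rewrite /f' mulNr addrA subrr add0r.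
apply: PD => //; apply: IH => // [h []|v v0].
- by move=> -> k u v; rewrite /f' linf ling !mulrDr; ring.
- exact: linfs.
have /eqP gaN0 := ga.
(* Moving [v] along [a] into the kernel of [g] keeps it in the common kernel of [fs], and [f] takes
   the value [f' v] there. *)
have -> : f' v = f (- (g v / g a) *: a + v).
  by rewrite linf /f' /c; congr (_ + _); field.
apply: ker => h [<-|hfs]; first by rewrite ling mulNr divfK// addNr.
by rewrite linfs// (a0 h hfs) (v0 h hfs) mulr0 addr0.
Qed.

Lemma cvg_initial (S : choiceType) (T : topologicalType) (f : S -> T)
    (F : set_system S) (s : S) : Filter F ->
  F --> (s : initial_topology f) <-> f @ F --> f s.
Proof.
move=> FF; split=> [Fs|Fs U [_ [[W oW <-] Ws WU]]].
  by apply: cvg_comp Fs _; exact: initial_continuous.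
by apply: filterS WU _; apply: Fs; exact: open_nbhs_nbhs.
Qed.

Lemma cvg_ptws (U : Type) (V : topologicalType) (F : set_system (U -> V))
    (f : U -> V) : Filter F ->
  {ptws, F --> f} <-> forall t, g t @[g --> F] --> f t.
Proof.
move=> FF; rewrite cvg_sup; split=> Ff t.
  move=> W Wt; apply: (Ff t).
  exact: (@initial_continuous _ _ (fun g : U -> V => g t)) Wt.
move=> W; apply: (@cvg_initial _ _ (fun g : U -> V => g t) F f FF).2.
exact: Ff.
Qed.

Section wstar_lemmas.
Variables (R : realType) (B : dualBanachAlgebra R).

Lemma wstar_nbhs_cvg (F : set_system B) (FF : Filter F) (b : B) :
  (forall f, predual f -> (fun c => f c : (R[i])^o) @ F --> f b) ->
  F --> (b : wstar B).
Proof.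
move=> Fb; apply/cvg_initial/cvg_ptws => -[f Pf]; exact: Fb.
Qed.

Lemma continuous_predual (f : dual B) :
  predual f -> continuous (f : wstar B -> (R[i])^o).
Proof.
move=> Pf b.
have /cvg_ptws/(_ (exist _ f Pf)) :
    {ptws, (@predual_eval R B) @ nbhs (b : wstar B) --> predual_eval b}.
  exact: initial_continuous.
exact.
Qed.

Lemma wstar_continuousP (E : normedModType R[i]) (T : B -> dual E) :
  wstar_continuous T <->
  forall x, continuous ((fun b => T b x) : wstar B -> (R[i])^o).
Proof.
split=> [cT x b|cT].
  have h : {ptws, (fun c : wstar B => (T c : E -> (R[i])^o)) @ nbhs b -->
      (T b : E -> (R[i])^o)}.
    apply: cvg_comp; first exact: cT.
    exact: (@initial_continuous _ _ (@dual_eval R E)).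
  exact: ((cvg_ptws _ _).1 h x).
apply: continuous_comp_initial => b.
apply: ((@cvg_ptws _ _ ((@dual_eval R E \o T) @ nbhs (b : wstar B)) _ _).2).
by move=> x; exact: cT.
Qed.

(** A w*-continuous functional is less than 1 in modulus on the common kernel of finitely many
    predual elements. On a subspace this forces it to vanish, so it is a combination of these
    elements. *)
Lemma wstar_functional (L : B -> (R[i])^o) :
  linear L -> continuous (L : wstar B -> (R[i])^o) ->
  exists2 f : dual B, predual f & forall b, L b = f b.
Proof.
move=> lL cL.
(* The filter generated by finite intersections of kernels of predual elements. It converges to 0,
   which spares a description of the basic w*-neighbourhoods. *)
pose N : set_system B := [set U | exists fs : seq (B -> R[i]),
  (forall g, List.In g fs -> exists2 f : dual B, predual f & g = f) /\
  forall b, (forall g, List.In g fs -> g b = 0) -> U b].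
have NF : Filter N.
  split.
  - by exists [::].
  - move=> U V [fs [Pfs Ufs]] [gs [Pgs Vgs]]; exists (fs ++ gs); split.
      by move=> g hg; have [/Pfs|/Pgs] := List.in_app_or _ _ _ hg.
    move=> b b0; split; [apply: Ufs|apply: Vgs] => g hg; apply: b0.
      by apply: List.in_or_app; left.
    by apply: List.in_or_app; right.
  - by move=> U V UV [fs [Pfs Ufs]]; exists fs; split=> // b /Ufs/UV.
have N0 : N --> (0 : wstar B).
  apply: wstar_nbhs_cvg => f Pf U U0; exists [:: (f : B -> R[i])]; split.
    by move=> _ [<-|//]; exists f.
  move=> b /(_ f (or_introl erefl)) b0.
  have fb0 : f b = f 0 by rewrite linear0; exact: b0.
  by rewrite /preimage/= fb0; exact: nbhs_singleton.
have L0 : L 0 = 0.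
  have := lL 1 0 0; rewrite !scale1r addr0 => /eqP.
  by rewrite -subr_eq0 opprD addrA subrr sub0r oppr_eq0 => /eqP.
have [fs [Pfs Lfs]] : N [set b | `|L b| < 1].
  apply: N0; have := cL 0 [set z | `|z| < 1]; apply.
  rewrite -[X in nbhs X _]/(L 0) L0.
  have := nbhsx_ballx (0 : (R[i])^o) 1 ltr01; rewrite -ball_normE.
  by apply: filterS => z /=; rewrite sub0r normrN.
have ker b : (forall g, List.In g fs -> g b = 0) -> L b = 0.
  move=> b0; apply: contrapT => /eqP Lb.
  have LZ k v : L (k *: v) = (k : R[i]) * L v.
    by rewrite -[k *: v]addr0 lL L0 addr0.
  (* If [L b] were nonzero, [b / L b] would lie in the common kernel, where [L] would take the value
     1. *)
  have kerb g : List.In g fs -> g ((L b : R[i])^-1 *: b) = 0.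
    move=> gfs; have [f Pf gf] := Pfs g gfs.
    have := b0 _ gfs; rewrite gf => fb0.
    by rewrite dual_appZ fb0 mulr0.
  by have /= := Lfs _ kerb; rewrite LZ mulVf// normr1 ltxx.
apply: (@mem_span_of_kernels R[i] B
  [set L : B -> R[i] | exists2 f : dual B, predual f & forall b, L b = f b] fs).
- by exists 0 => //; exact: predual0.
- move=> k g1 g2 [f Pf fE] [g Pg gE]; exists (k *: f + g).
    exact: predualP.
  by move=> b; rewrite fE gE.
- by move=> g /Pfs[f Pf ->]; exists f.
- move=> g [->|/Pfs[f Pf ->]] k u v; first exact: lL.
  exact: dual_linear.
- exact: ker.
Qed.

End wstar_lemmas.

(** * Amenability of A implies Connes-amenability of A** *)

Lemma linear_continuousP (R : realType) (V W : normedModType R[i]) (T : V -> W) :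
  linear T ->
  continuous T <-> exists2 K : R[i], 0 <= K & forall x, `|T x| <= K * `|x|.
Proof.
move=> lT; pose F : {linear V -> W} := HB.pack T (GRing.isLinear.Build _ _ _ _ T lT).
split=> [cT|[M M0 TM]].
  have /linear_boundedP/pinfty_ex_gt0[M M0 TM] :=
    (@linear_bounded_continuous _ _ _ F).2 cT.
  by exists M; [exact: ltW|exact: TM].
apply/(@linear_bounded_continuous _ _ _ F)/linear_boundedP.
exists M; split; first exact: ger0_real.
by move=> r Mr x; rewrite (le_trans (TM _))// ler_wpM2r// ltW.
Qed.

Lemma continuous_sub (R : realType) (T : topologicalType) (f g : T -> (R[i])^o) :
  continuous f -> continuous g ->
  continuous (fun x => f x - g x : (R[i])^o).
Proof. by move=> cf cg x; apply: cvgB; [exact: cf|exact: cg]. Qed.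

Section restrict_scalars.
Variables (R : realType) (A : banachAlgType R) (E : banachBimodule (bidual A)).

Lemma bidual_embed_linear : linear (@bidual_embed R A).
Proof. exact: canonical_is_linear. Qed.

Lemma bidual_embed_norm (a : A) : `|bidual_embed a| = `|a|.
Proof. exact: canonical_norm. Qed.

Definition restrict_bimodule : banachBimodule A.
Proof.
refine (@BanachBimodule R A E (fun a x => lact (bidual_embed a) x)
  (fun x a => ract x (bidual_embed a)) _ _ _ _ _ _ _ _).
- by move=> x k a b; rewrite bidual_embed_linear lact_linearl.
- by move=> a; exact: lact_linearr.
- by move=> a; exact: ract_linearl.
- by move=> x k a b; rewrite bidual_embed_linear ract_linearr.
- by move=> a b x; rewrite bidual_embedM lactM.
- by move=> x a b; rewrite bidual_embedM ractM.
- by move=> a x b; exact: lractA.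
- have [K K0 Kb] := act_bounded E; exists K => // a x.
  by rewrite -bidual_embed_norm; exact: Kb.
Defined.

End restrict_scalars.

Section amenable_connes.
Variables (R : realType) (A : banachAlgType R) (hA : arens_regular A).
Let B := bidual_dual_banach_algebra hA.

Lemma wstar_functional_bidual (L : bidual A -> (R[i])^o) :
  linear L -> continuous (L : wstar B -> (R[i])^o) ->
  exists f : dual A, forall F, L F = F f.
Proof.
by move=> lL cL; have [_ [f _ <-] LE] := @wstar_functional R B L lL cL; exists f.
Qed.

(** The predual is the canonical image of [dual A], so each component of [T] is a predual element.
    The actions and derivations constructed below are shown to be w*-continuous in this way. *)
Lemma wstar_continuous_bidual (E : normedModType R[i]) (T : bidual A -> dual E) :
  (forall x, exists f : dual A, forall F, T F x = F f) ->
  @wstar_continuous R B E T.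
Proof.
move=> Tf; apply/wstar_continuousP => x; have [f fE] := Tf x.
have -> : (fun b : bidual A => T b x : (R[i])^o) = (canonical f : dual (bidual A)).
  by apply/funext => F; rewrite fE.
by apply: (@continuous_predual R B); exists f.
Qed.

Lemma amenable_connes_amenable : amenable A -> connes_amenable B.
Proof.
move=> amA E wE D [lD cD dD] wD.
pose D' : A -> dual_bimodule (restrict_bimodule E) := fun a => D (bidual_embed a).
have [|phi phiE] := amA (restrict_bimodule E) D'.
  split.
  - by move=> k a b; rewrite /D' bidual_embed_linear lD.
  - move=> a; apply: continuous_comp (cD _).
    apply: (linear_continuousP (@bidual_embed_linear R A)).2.
    by exists 1 => // x; rewrite mul1r bidual_embed_norm.
  - by move=> a b; rewrite /D' bidual_embedM dD; apply: dualP.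
pose phi' : dual_bimodule E := phi.
exists phi' => F; apply/eqP; rewrite -subr_eq0; apply/eqP; apply: dualP => x.
pose L (G : bidual A) : (R[i])^o := (D G - (lact G phi' - ract phi' G)) x.
have LE G : L G = D G x - (lact G phi' x - ract phi' G x) by [].
have lL : linear L.
  move=> k G H; rewrite !LE lD.
  rewrite lact_linearl ract_linearr !dualE -[RHS]/(k * _ + _); ring.
have cL : continuous (L : wstar B -> (R[i])^o).
  have /wstar_continuousP cD' := wD.
  have [/wstar_continuousP cl /wstar_continuousP cr] := wE phi'.
  have -> : L = fun G => D G x - (lact G phi' x - ract phi' G x).
    exact/funext.
  apply: (@continuous_sub R (wstar B) (fun G => D G x)); first exact: cD'.
  apply: (@continuous_sub R (wstar B) (fun G => lact G phi' x)); first exact: cl.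
  exact: cr.
have [f fE] := wstar_functional_bidual lL cL.
(* The w*-density of [A] takes this form: a w*-continuous functional is evaluation at some [f] in
   the dual of [A], and [f] is determined by its values on [A]. *)
suff f0 : f = 0 by rewrite -[LHS]/(L F) fE f0 dual_app0.
apply: dualP => a; rewrite -[f a]/(bidual_embed a f) -fE LE.
by rewrite -[D _]/(D' a) phiE subrr.
Qed.

End amenable_connes.

(** * Connes-amenability of A** implies amenability of A *)

Section connes_unit.
Variables (R : realType) (A : banachAlgType R) (hA : arens_regular A).
Let B := bidual_dual_banach_algebra hA.

(* The dual of this module is [bidual A] with its left multiplication. *)
Definition right_predual_bimodule : banachBimodule (bidual A).
Proof.
refine (@BanachBimodule R (bidual A) (dual A) (fun _ _ => 0)
  (fun f F => bidual_ract f F) _ _ _ _ _ _ _ _).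
- by move=> f k F G; rewrite scaler0 addr0.
- by move=> F k f g; rewrite scaler0 addr0.
- exact: bidual_ractP.
- by move=> f k F G; apply: dualP.
- by [].
- move=> f F G; apply: dualP => a.
  rewrite -[LHS]/(arens1 F G _) hA /=; congr (G _).
  by apply: dualP => b /=; congr (F _); apply: dualP => c /=; rewrite amulA.
- move=> F f G; apply: dualP => a /=; rewrite -[RHS](dual_app0 G).
  by congr (G _); apply: dualP.
- exists 1 => // F f; rewrite !mul1r normr0 mulr_ge0//; split=> //.
  by rewrite mulrC; exact: bidual_ract_norm.
Defined.

(** The mirror image: its dual is [bidual A] with its right multiplication and zero left action. *)
Definition left_predual_bimodule : banachBimodule (bidual A).
Proof.
refine (@BanachBimodule R (bidual A) (dual A) (fun F f => bidual_lact F f)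
  (fun _ _ => 0) _ _ _ _ _ _ _ _).
- by move=> f k F G; apply: dualP.
- exact: bidual_lactP.
- by move=> F k f g; rewrite scaler0 addr0.
- by move=> f k F G; rewrite scaler0 addr0.
- move=> F G f; apply: dualP => a /=; congr (F _); apply: dualP => b /=.
  by congr (G _); apply: dualP => c /=; rewrite amulA.
- by [].
- move=> F f G; apply: dualP => a /=; rewrite -[LHS](dual_app0 F).
  by congr (F _); apply: dualP.
- exists 1 => // F f; rewrite !mul1r normr0 mulr_ge0//; split=> //.
  exact: bidual_lact_norm.
Defined.

(** As the right action on the dual module is zero, the identity map is a derivation, and an element
    [e] implementing it satisfies [F = F e]. Arens regularity makes [F |-> F Phi] w*-continuous for
    the second product too. *)
Lemma connes_amenable_right_unit : connes_amenable B ->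
  exists e : bidual A, forall F, amul F e = F.
Proof.
move=> cB; have wE : @wstar_bimodule R B right_predual_bimodule.
  move=> Phi; split; apply: wstar_continuous_bidual => f.
    by exists (bidual_lact Phi f) => F; rewrite -[LHS]/(arens2 F Phi f) -hA.
  by exists 0 => F; rewrite dual_app0 -[LHS]/(Phi 0) dual_app0.
have [||e eE] := cB _ wE (id : bidual A -> bidual A).
- split=> [//|x|F G]; first exact: cvg_id.
  apply: dualP => f; rewrite -[RHS]/(arens2 F G f + F 0).
  by rewrite dual_app0 addr0 -hA.
- by apply: wstar_continuous_bidual => f; exists f.
exists e => F; rewrite [RHS]eE; apply: dualP => f.
by rewrite -[RHS]/(arens2 F e f - e 0) dual_app0 subr0 -hA.
Qed.

Lemma connes_amenable_left_unit : connes_amenable B ->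
  exists e : bidual A, forall F, amul e F = F.
Proof.
move=> cB; have wE : @wstar_bimodule R B left_predual_bimodule.
  move=> Phi; split; apply: wstar_continuous_bidual => f.
    by exists 0 => F; rewrite dual_app0 -[LHS]/(Phi 0) dual_app0.
  by exists (bidual_ract f Phi) => F; rewrite -[LHS]/(arens1 Phi F f) hA.
have [||e eE] := cB _ wE (id : bidual A -> bidual A).
- split=> [//|x|F G]; first exact: cvg_id.
  by apply: dualP => f; rewrite -[RHS]/(G 0 + arens1 F G f) dual_app0 add0r.
- by apply: wstar_continuous_bidual => f; exists f.
(* With zero left action the inner derivation of [e] is [F |-> - e F], hence the sign. *)
exists (- e) => F; rewrite [RHS]eE; apply: dualP => f.
by rewrite -[RHS]/(e 0 - arens1 e F f) dual_app0 add0r.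
Qed.

Lemma connes_amenable_unit : connes_amenable B ->
  exists e : bidual A, forall F, amul e F = F /\ amul F e = F.
Proof.
move=> cB; have [e eP] := connes_amenable_right_unit cB.
have [e' e'P] := connes_amenable_left_unit cB.
by exists e => F; split; rewrite ?eP// -[e](e'P e) eP e'P.
Qed.

End connes_unit.

Section unit_evaluation.
Variables (R : realType) (A : banachAlgType R) (e : bidual A).
Hypothesis eP : forall F : bidual A, amul e F = F /\ amul F e = F.

(** [e g] is the value at [f] of the product of [e] with the image of [c]. It stands for the limit
    of [f (e_i c)] along a bounded approximate identity [e_i]. *)
Lemma unit_eval_mulr (f g : dual A) (c : A) :
  (forall a, g a = f (amul a c)) -> e g = f c.
Proof.
move=> gf; rewrite -[f c]/(bidual_embed c f) -(eP (bidual_embed c)).1.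
by congr (e _); apply: dualP => a; rewrite gf.
Qed.

Lemma unit_eval_mull (f g : dual A) (c : A) :
  (forall a, g a = f (amul c a)) -> e g = f c.
Proof.
move=> gf; rewrite -[f c]/(bidual_embed c f) -(eP (bidual_embed c)).2.
by rewrite -[RHS]/(e _); congr (e _); apply: dualP => a; rewrite gf.
Qed.

End unit_evaluation.

(** * Extension of operators and actions to the bidual *)

Section bidual_extension.
Variables (R : realType) (V W : normedModType R[i]) (T : V -> dual W).
Hypothesis lT : linear T.
Hypothesis bT : exists2 K : R[i], 0 <= K & forall v, `|T v| <= K * `|v|.

Fact slice_linear x : linear ((fun v => T v x) : V -> (R[i])^o).
Proof. by move=> k u v; rewrite lT. Qed.

Fact slice_bounded x :
  exists2 M : R[i], 0 <= M & forall v, `|T v x| <= M * `|v|.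
Proof.
have [K K0 TK] := bT; exists (K * `|x|) => [|v]; first by rewrite mulr_ge0.
by rewrite (le_trans (dual_opnorm _ _))// mulrAC ler_wpM2r.
Qed.

Definition slice x : dual V := mk_dual (slice_linear x) (slice_bounded x).

Lemma slice_linearr : linear slice.
Proof. by move=> k x y; apply: dualP => v /=; rewrite linearP. Qed.

Lemma slice_norm K : 0 <= K -> (forall v, `|T v| <= K * `|v|) ->
  forall x, `|slice x| <= K * `|x|.
Proof.
move=> K0 TK x; apply: dual_opnorm_le => [|v]; first by rewrite mulr_ge0.
by rewrite (le_trans (dual_opnorm (T v) x))// mulrAC ler_wpM2r.
Qed.

Fact bidual_ext_linear (F : dual (dual V)) :
  linear ((fun x => F (slice x)) : W -> (R[i])^o).
Proof. by move=> k x y; rewrite slice_linearr linearP. Qed.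

Fact bidual_ext_bounded (F : dual (dual V)) :
  exists2 M : R[i], 0 <= M & forall x, `|F (slice x)| <= M * `|x|.
Proof.
have [K K0 TK] := bT; exists (`|F| * K) => [|x]; first by rewrite mulr_ge0.
rewrite (le_trans (dual_opnorm F _))// -mulrA ler_wpM2l//.
exact: slice_norm.
Qed.

(** The adjoint of [slice], which maps [W] to the dual of [V]; hence the extension of [T] is
    w*-continuous. *)
Definition bidual_ext (F : dual (dual V)) : dual W :=
  mk_dual (bidual_ext_linear F) (bidual_ext_bounded F).

Lemma bidual_ext_norm K : 0 <= K -> (forall v, `|T v| <= K * `|v|) ->
  forall F, `|bidual_ext F| <= K * `|F|.
Proof.
move=> K0 TK F; apply: dual_opnorm_le => [|x]; first by rewrite mulr_ge0.
by rewrite (le_trans (dual_opnorm F _))// (mulrC K) -mulrA ler_wpM2l// slice_norm.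
Qed.

End bidual_extension.

Section bidual_actions.
Variables (R : realType) (A : banachAlgType R) (E : banachBimodule A).
Implicit Types (F G : bidual A) (f : dual E) (a : A) (x : E).

Fact dual_lact_linearl f : linear (fun a => dual_lact a f).
Proof. exact: (@lact_linearl _ _ (dual_bimodule E) f). Qed.

Fact dual_ract_linearr f : linear (dual_ract f).
Proof. exact: (@ract_linearr _ _ (dual_bimodule E) f). Qed.

Fact dual_lact_boundedl f :
  exists2 K : R[i], 0 <= K & forall a, `|dual_lact a f| <= K * `|a|.
Proof.
have [K K0 Kb] := act_bounded (dual_bimodule E); exists (K * `|f|) => [|a].
  by rewrite mulr_ge0.
by rewrite -mulrA [`|f| * _]mulrC; exact: (Kb a f).1.
Qed.

Fact dual_ract_boundedr f :
  exists2 K : R[i], 0 <= K & forall a, `|dual_ract f a| <= K * `|a|.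
Proof.
have [K K0 Kb] := act_bounded (dual_bimodule E); exists (K * `|f|) => [|a].
  by rewrite mulr_ge0.
by rewrite -mulrA; exact: (Kb a f).2.
Qed.

(* <x, F.f> = F (a |-> <x.a, f>) *)
Definition ext_lact F f : dual E :=
  bidual_ext (dual_lact_linearl f) (dual_lact_boundedl f) F.

(* <x, f.F> = F (a |-> <a.x, f>) *)
Definition ext_ract f F : dual E :=
  bidual_ext (dual_ract_linearr f) (dual_ract_boundedr f) F.

Lemma ext_lactP F f x (g : dual A) :
  (forall a, g a = f (ract x a)) -> ext_lact F f x = F g.
Proof. by move=> gf; rewrite /=; congr (F _); apply: dualP. Qed.

Lemma ext_ractP F f x (g : dual A) :
  (forall a, g a = f (lact a x)) -> ext_ract f F x = F g.
Proof. by move=> gf; rewrite /=; congr (F _); apply: dualP. Qed.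

End bidual_actions.

(** * Derivations that annihilate A.E.A *)

Section annihilating_derivation.
Variables (R : realType) (A : banachAlgType R) (E : banachBimodule A).
Variable e : bidual A.
Hypothesis eP : forall F : bidual A, amul e F = F /\ amul F e = F.

(** Evaluating the derivation identity at [e] gives [D c = c.eta + eta.c], where [eta] plays the
    limit of [D e_i]. As [eta] kills [A.E.A], multiplying it by [e] on the left keeps [c.eta] and
    removes [eta.c], and on the right the reverse; the difference [xi] of the two products therefore
    implements [D]. *)
Lemma derivation_inner_of_annihilating (D : A -> dual_bimodule E) :
  derivation D -> (forall a b c x, (D c : dual E) (lact a (ract x b)) = 0) ->
  inner D.
Proof.
move=> [lD cD dD] D0.
have bD := (linear_continuousP lD).1 cD.
pose eta : dual E := bidual_ext lD bD e.
pose sl (x : E) : dual A := slice lD bD x.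
pose xi : dual E := ext_lact e eta - ext_ract eta e.
have dDE a b x : (D (amul a b) : dual E) x =
  (D b : dual E) (ract x a) + (D a : dual E) (lact b x) by rewrite dD.
pose sl_l (f : dual E) x : dual A :=
  slice (dual_lact_linearl f) (dual_lact_boundedl f) x.
pose sl_r (f : dual E) x : dual A :=
  slice (dual_ract_linearr f) (dual_ract_boundedr f) x.
(* [lE] and [rE] apply [e], in the variable [a], to the derivation identity for [a c] and for
   [c a]. *)
have lE c x : (D c : dual E) x = e (sl_l (D c) x) + eta (lact c x).
  rewrite -[eta _]/(e (sl _)) -dual_appD; symmetry.
  by apply: (unit_eval_mulr eP (f := sl x)) => a; rewrite [RHS]dDE.
have rE c x : (D c : dual E) x = eta (ract x c) + e (sl_r (D c) x).
  rewrite -[eta _]/(e (sl _)) -dual_appD; symmetry.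
  by apply: (unit_eval_mull eP (f := sl x)) => a; rewrite [RHS]dDE.
have eta0 a b x : eta (lact a (ract x b)) = 0.
  rewrite -[LHS]/(e (sl _)) -[RHS](dual_app0 e); congr (e _).
  by apply: dualP => c; exact: D0.
(* In the last term of [rE], the value of [D c] at [a x] is expanded by [lE]: the part in [A.E.A]
   vanishes and [eta (c a x)] remains, where [e] replaces [c a] by [c]. *)
have DE c x : (D c : dual E) x = eta (ract x c) + eta (lact c x).
  rewrite rE; congr (_ + _).
  apply: (unit_eval_mull eP (f := sl_r eta x)) => a.
  rewrite -[LHS]/((D c : dual E) (lact a x)) lE -lactM -[RHS]add0r; congr (_ + _).
  rewrite -[RHS](dual_app0 e); congr (e _); apply: dualP => b.
  by rewrite -[LHS]/((D c : dual E) (ract (lact a x) b)) lractA D0.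
exists xi => c; apply: dualP => x.
rewrite -[RHS]/((ext_lact e eta (ract x c) - ext_ract eta e (ract x c)) -
  (ext_lact e eta (lact c x) - ext_ract eta e (lact c x))).
have -> : ext_lact e eta (ract x c) = eta (ract x c).
  apply: (unit_eval_mull eP (f := sl_l eta x)) => a /=.
  by rewrite ractM.
have -> : ext_ract eta e (lact c x) = eta (lact c x).
  apply: (unit_eval_mulr eP (f := sl_r eta x)) => a /=.
  by rewrite lactM.
have -> : ext_ract eta e (ract x c) = 0.
  transitivity (e (0 : dual A)); last exact: dual_app0.
  by apply: ext_ractP => a; rewrite eta0.
have -> : ext_lact e eta (lact c x) = 0.
  transitivity (e (0 : dual A)); last exact: dual_app0.
  by apply: ext_lactP => a; rewrite lractA eta0.
by rewrite DE subr0 sub0r opprK.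
Qed.

End annihilating_derivation.

Lemma equalizer_closed (R : realType) (V : normedModType R[i]) (f g : dual V) :
  closed [set x | f x = g x].
Proof.
have -> : [set x | f x = g x] = (f - g : dual V) @^-1` [set 0].
  apply/seteqP; split=> x; rewrite /preimage.
    by move=> /= fgx; apply/eqP; rewrite subr_eq0; exact/eqP.
  by move=> /eqP; rewrite subr_eq0 => /eqP.
apply: preimage_closed; first by move=> x _; exact: dual_continuous.
apply: accessible_closed_set1; apply: hausdorff_accessible.
exact: norm_hausdorff.
Qed.

(** * The essential part of a bimodule *)

Section essential_part.
Variables (R : realType) (A : banachAlgType R) (E : banachBimodule A).

(* The closed linear span of A.E.A *)
Definition ess_set : set E := [set x | forall Y : closed_submodule E,
  (forall a b y, csub_set Y (lact a (ract y b))) -> csub_set Y x].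

Fact ess_closed : closed ess_set.
Proof.
move=> x clx Y AYA; apply: (@csub_closed _ _ Y) => U /clx[y [Xy Uy]].
by exists y; split=> //; exact: Xy.
Qed.

Fact ess0 : ess_set 0. Proof. by move=> Y _; exact: csub0. Qed.

Fact essP (k : R[i]) x y : ess_set x -> ess_set y -> ess_set (k *: x + y).
Proof. by move=> Xx Xy Y AYA; apply: csubP; [exact: Xx|exact: Xy]. Qed.

Definition ess : closed_submodule E := ClosedSubmodule ess_closed ess0 essP.

Lemma ess_gen a b y : csub_set ess (lact a (ract y b)).
Proof. by move=> Y; apply. Qed.

(** The equalizer of [f] and [g] is a closed submodule containing the generators. *)
Lemma ess_ext (f g : dual E) :
  (forall a b y, f (lact a (ract y b)) = g (lact a (ract y b))) ->
  forall x, csub_set ess x -> f x = g x.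
Proof.
move=> fg x Xx; apply: (Xx (ClosedSubmodule (@equalizer_closed _ _ f g) _ _)) => //.
- by rewrite /= !dual_app0.
- by move=> k u v /= fu fv; rewrite !dual_appD !dual_appZ fu fv.
Qed.

End essential_part.

(** * The action of the bidual on the essential part *)

Section multipliers.
Variables (R : realType) (A : banachAlgType R) (E : banachBimodule A).
Implicit Types (F G : bidual A) (f : dual E) (a b c : A) (x : E).

(** Acting on the right by [F] and then [G] evaluates [F] inside [G], which is the second Arens
    product; regularity identifies it with [amul]. The left action follows the first product
    directly. *)
Lemma ext_ractM (hA : arens_regular A) f F G :
  ext_ract f (amul F G) = ext_ract (ext_ract f F) G.
Proof.
apply: dualP => x; rewrite -[LHS]/(arens1 F G _) hA /=; congr (G _).
apply: dualP => b /=; congr (F _); apply: dualP => a /=.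
by rewrite lactM.
Qed.

Lemma ext_lactM F G f : ext_lact (amul F G) f = ext_lact F (ext_lact G f).
Proof.
apply: dualP => x /=; congr (F _); apply: dualP => a /=.
by congr (G _); apply: dualP => b /=; rewrite ractM.
Qed.

(** In effect [G.(c.x) = (G c).x]. When [A] is an ideal, [G c] comes from some [c'] in [A], so the
    evaluation at [G] turns into an ordinary action. *)
Lemma ext_ract_lact f G c c' x : bidual_embed c' = amul G (bidual_embed c) ->
  ext_ract f G (lact c x) = f (lact c' x).
Proof.
move=> cc'; pose h := slice (dual_ract_linearr f) (dual_ract_boundedr f) x.
rewrite -[RHS]/(bidual_embed c' h) cc' /=; congr (G _).
by apply: dualP => a /=; rewrite lactM.
Qed.

Lemma ext_lact_ract f F c c' x : bidual_embed c' = amul (bidual_embed c) F ->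
  ext_lact F f (ract x c) = f (ract x c').
Proof.
move=> cc'; pose h := slice (dual_lact_linearl f) (dual_lact_boundedl f) x.
rewrite -[RHS]/(bidual_embed c' h) cc' /=; congr (F _).
by apply: dualP => a /=; rewrite ractM.
Qed.

(** The two sides evaluate [F] and [G] in opposite orders. On a generator of [ess E] the left factor
    [c] absorbs [G] into an element of [A], so that only [F] is left. *)
Lemma ext_lract (hI : ideal (range (@bidual_embed R A))) F G f x :
  csub_set (ess E) x ->
  ext_lact F (ext_ract f G) x = ext_ract (ext_lact F f) G x.
Proof.
apply: ess_ext => c d y; have [_ _ hM] := hI.
have [[c' _ c'E] _] := hM G (bidual_embed c) (ex_intro2 _ _ c Logic.I erefl).
rewrite (ext_ract_lact _ _ c'E).
apply: ext_lactP => a; rewrite lractA (ext_ract_lact _ _ c'E).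
by rewrite -[LHS]/(f (ract _ a)) !lractA.
Qed.

Fact ext_ract_linearl F : linear (fun f => ext_ract f F).
Proof.
move=> k f g; apply: dualP => x.
transitivity (F (k *: slice (dual_ract_linearr f) (dual_ract_boundedr f) x +
  slice (dual_ract_linearr g) (dual_ract_boundedr g) x)).
  by congr (F _); apply: dualP.
exact: dual_linear.
Qed.

Fact ext_lact_linearr F : linear (fun f => ext_lact F f).
Proof.
move=> k f g; apply: dualP => x.
transitivity (F (k *: slice (dual_lact_linearl f) (dual_lact_boundedl f) x +
  slice (dual_lact_linearl g) (dual_lact_boundedl g) x)).
  by congr (F _); apply: dualP.
exact: dual_linear.
Qed.

Fact ext_act_bounded : exists2 K : R[i], 0 <= K & forall F f,
  `|ext_lact F f| <= K * `|F| * `|f| /\ `|ext_ract f F| <= K * `|F| * `|f|.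
Proof.
have [K K0 Kb] := act_bounded (dual_bimodule E); exists K => // F f.
rewrite mulrAC; split; apply: bidual_ext_norm; rewrite ?mulr_ge0// => a.
  by rewrite -mulrA [`|f| * _]mulrC; exact: (Kb a f).1.
by rewrite -mulrA; exact: (Kb a f).2.
Qed.

Fact ext_ract_boundedl F :
  exists2 K : R[i], 0 <= K & forall f, `|ext_ract f F| <= K * `|f|.
Proof.
have [K K0 Kb] := ext_act_bounded; exists (K * `|F|) => [|f].
  by rewrite mulr_ge0.
exact: (Kb F f).2.
Qed.

Fact ext_lact_boundedr F :
  exists2 K : R[i], 0 <= K & forall f, `|ext_lact F f| <= K * `|f|.
Proof.
have [K K0 Kb] := ext_act_bounded; exists (K * `|F|) => [|f].
  by rewrite mulr_ge0.
exact: (Kb F f).1.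
Qed.

(* [left_image F x] and [right_image x F] are the products F.x and x.F, in the
   bidual of [E]. *)
Definition left_image F x : dual (dual E) :=
  slice (ext_ract_linearl F) (ext_ract_boundedl F) x.
Definition right_image x F : dual (dual E) :=
  slice (ext_lact_linearr F) (ext_lact_boundedr F) x.

Lemma image_bounded : exists2 K : R[i], 0 <= K & forall F x,
  `|left_image F x| <= K * (`|F| * `|x|) /\
  `|right_image x F| <= K * (`|x| * `|F|).
Proof.
have [K K0 Kb] := ext_act_bounded; exists K => // F x.
rewrite [`|x| * _]mulrC mulrA.
split; apply: slice_norm; rewrite ?mulr_ge0// => f; first exact: (Kb F f).2.
exact: (Kb F f).1.
Qed.

Hypothesis hI : ideal (range (@bidual_embed R A)).

(** A priori [F.x] lies in the bidual of [E]. The points for which it comes from [ess E] form a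
    closed submodule, and it contains each [a.y.b] because [F a] is in [A]. *)
Lemma left_image_ess F x : csub_set (ess E) x ->
  exists2 u, csub_set (ess E) u & canonical u = left_image F x.
Proof.
have [K K0 Kb] := image_bounded; have [_ _ hM] := hI.
pose L := left_image F.
have lL : linear L by exact: slice_linearr.
pose S := [set x | exists2 u, csub_set (ess E) u & canonical u = L x].
have cl : closed S.
  apply: (@closed_canonical_preimage _ _ _ _ _ (K * `|F|)) => //.
  - exact: csub_closed.
  - by rewrite mulr_ge0.
  - by move=> y; rewrite -mulrA; exact: (Kb F y).1.
have S0 : S 0.
  exists 0; first exact: csub0.
  by apply: dualP => f; rewrite -[LHS]/(f 0) -[RHS]/(ext_ract f F 0) !dual_app0.
have SP (k : R[i]) u v : S u -> S v -> S (k *: u + v).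
  move=> [u' Xu uE] [v' Xv vE]; exists (k *: u' + v'); first exact: csubP.
  by rewrite canonical_is_linear uE vE lL.
move=> Xx; apply: (Xx (ClosedSubmodule cl S0 SP)) => a b y.
have [[c _ cE] _] := hM F (bidual_embed a) (ex_intro2 _ _ a Logic.I erefl).
exists (lact c (ract y b)); first exact: ess_gen.
by apply: dualP => f; rewrite [RHS](ext_ract_lact _ _ cE).
Qed.

Lemma right_image_ess x F : csub_set (ess E) x ->
  exists2 u, csub_set (ess E) u & canonical u = right_image x F.
Proof.
have [K K0 Kb] := image_bounded; have [_ _ hM] := hI.
pose L x := right_image x F.
have lL : linear L by exact: slice_linearr.
pose S := [set x | exists2 u, csub_set (ess E) u & canonical u = L x].
have cl : closed S.
  apply: (@closed_canonical_preimage _ _ _ _ _ (K * `|F|)) => //.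
  - exact: csub_closed.
  - by rewrite mulr_ge0.
  - by move=> y; rewrite -mulrA [`|F| * _]mulrC; exact: (Kb F y).2.
have S0 : S 0.
  exists 0; first exact: csub0.
  by apply: dualP => f; rewrite -[LHS]/(f 0) -[RHS]/(ext_lact F f 0) !dual_app0.
have SP (k : R[i]) u v : S u -> S v -> S (k *: u + v).
  move=> [u' Xu uE] [v' Xv vE]; exists (k *: u' + v'); first exact: csubP.
  by rewrite canonical_is_linear uE vE lL.
move=> Xx; apply: (Xx (ClosedSubmodule cl S0 SP)) => a b y.
have [_ [c _ cE]] := hM F (bidual_embed b) (ex_intro2 _ _ b Logic.I erefl).
exists (lact a (ract y c)); first exact: ess_gen.
by apply: dualP => f; rewrite -!lractA [RHS](ext_lact_ract _ _ cE).
Qed.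

Let X := csub (ess E).

Fact ess_lact_ex F (x : X) : exists u : X,
  forall f : dual E, f (csub_val u) = ext_ract f F (csub_val x).
Proof.
have [u Xu uE] := left_image_ess F (csub_valP x).
by exists (mk_csub Xu) => f; rewrite -[LHS]/(canonical u f) uE.
Qed.

Fact ess_ract_ex (x : X) F : exists u : X,
  forall f : dual E, f (csub_val u) = ext_lact F f (csub_val x).
Proof.
have [u Xu uE] := right_image_ess F (csub_valP x).
by exists (mk_csub Xu) => f; rewrite -[LHS]/(canonical u f) uE.
Qed.

(** The chosen point is unique since functionals separate points. For the same reason the module
    laws of [ess_bimodule] are checked on functionals, where they become laws of [ext_ract] and
    [ext_lact]. *)
Definition ess_lact F (x : X) : X := projT1 (cid (ess_lact_ex F x)).
Definition ess_ract (x : X) F : X := projT1 (cid (ess_ract_ex x F)).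

Lemma ess_lactE F (x : X) f :
  f (csub_val (ess_lact F x)) = ext_ract f F (csub_val x).
Proof. exact: (projT2 (cid (ess_lact_ex F x))). Qed.

Lemma ess_ractE (x : X) F f :
  f (csub_val (ess_ract x F)) = ext_lact F f (csub_val x).
Proof. exact: (projT2 (cid (ess_ract_ex x F))). Qed.

Definition ess_bimodule (hA : arens_regular A) : banachBimodule (bidual A).
Proof.
refine (@BanachBimodule R (bidual A) X ess_lact ess_ract _ _ _ _ _ _ _ _).
- move=> x k F G; apply: csub_sep => f.
  by rewrite csub_val_linear dual_appD dual_appZ !ess_lactE.
- move=> F k x y; apply: csub_sep => f.
  by rewrite csub_val_linear !(dual_appD, dual_appZ, ess_lactE, csub_val_linear).
- move=> F k x y; apply: csub_sep => f.
  by rewrite csub_val_linear !(dual_appD, dual_appZ, ess_ractE, csub_val_linear).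
- move=> x k F G; apply: csub_sep => f.
  by rewrite csub_val_linear dual_appD dual_appZ !ess_ractE.
- by move=> F G x; apply: csub_sep => f; rewrite !ess_lactE ext_ractM// ess_lactE.
- by move=> x F G; apply: csub_sep => f; rewrite !ess_ractE ext_lactM.
- move=> F x G; apply: csub_sep => f.
  rewrite (ess_ractE (ess_lact F x)) (ess_lactE F x) (ess_lactE F (ess_ract x G)).
  by rewrite (ess_ractE x) ext_lract//; exact: csub_valP.
- have [K K0 Kb] := image_bounded; exists K => // F x.
  have lE : canonical (csub_val (ess_lact F x)) = left_image F (csub_val x).
    by apply: dualP => f; exact: ess_lactE.
  have rE : canonical (csub_val (ess_ract x F)) = right_image (csub_val x) F.
    by apply: dualP => f; exact: ess_ractE.
  have [lK rK] := Kb F (csub_val x).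
  split; rewrite csub_norm -canonical_norm ?lE ?rE.
    exact: lK.
  exact: rK.
Defined.

End multipliers.

Section derivation_sub_inner.
Variables (R : realType) (A : banachAlgType R) (M : banachBimodule A).

Lemma derivation_sub_inner (D : A -> M) (x : M) : derivation D ->
  derivation (fun a => D a - (lact a x - ract x a)).
Proof.
move=> [lD cD dD].
have lI : linear (fun a => D a - (lact a x - ract x a)).
  move=> k a b; rewrite lD lact_linearl ract_linearr !opprB scalerDr scalerBr.
  by rewrite opprD [X in _ + X = _]addrACA [LHS]addrACA.
split=> //.
- apply: (linear_continuousP lI).2.
  have [K K0 DK] := (linear_continuousP lD).1 cD.
  have [L L0 xL] := act_bounded M.
  exists (K + (L * `|x| + L * `|x|)) => [|a]; first by rewrite !addr_ge0 ?mulr_ge0.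
  rewrite !mulrDl (le_trans (ler_normB _ _))// lerD//.
  rewrite (le_trans (ler_normB _ _))// lerD//; rewrite -mulrA; last exact: (xL a x).2.
  by rewrite [`|x| * _]mulrC; exact: (xL a x).1.
- move=> a b; rewrite dD lactM ractM.
  have lB u v : lact a (u - v) = lact a u - lact a v.
    by rewrite addrC -scaleN1r lact_linearr scaleN1r addrC.
  have rB u v : ract (u - v) b = ract u b - ract v b.
    by rewrite addrC -scaleN1r ract_linearl scaleN1r addrC.
  rewrite !lB !rB lractA !opprB [RHS]addrACA; congr (_ + _).
  by rewrite [RHS]addrC addrA subrK.
Qed.

End derivation_sub_inner.

(** * Lifting derivations to the bidual and descending again *)

Section connes_amenable_amenable.
Variables (R : realType) (A : banachAlgType R) (hA : arens_regular A).
Variable hI : ideal (range (@bidual_embed R A)).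
Let B := bidual_dual_banach_algebra hA.
Variable E : banachBimodule A.
Let X := ess_bimodule E hI hA.

(** Once a functional on the essential part is extended to [f] on [E], the value at [x] of its
    product with [F] is [F] evaluated at a slice of [f]. *)
Lemma ess_wstar_bimodule : @wstar_bimodule R B X.
Proof.
move=> g; have [f <-] := csub_extend g.
split; apply: wstar_continuous_bidual => x.
  exists (slice (dual_lact_linearl f) (dual_lact_boundedl f) (csub_val x)) => F.
  exact: (ess_ractE hI x F f).
exists (slice (dual_ract_linearr f) (dual_ract_boundedr f) (csub_val x)) => F.
exact: (ess_lactE hI F x f).
Qed.

(** The product rule for [D (b a)] is evaluated first by [G] in [a], then by [F] in [b], in the
    order of the first Arens product. *)
Lemma ess_lift_derivation (D : A -> dual_bimodule E) (lD : linear D)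
    (bD : exists2 K : R[i], 0 <= K & forall a, `|D a| <= K * `|a|) :
  (forall a b, D (amul a b) = lact a (D b) + ract (D a) b) ->
  derivation ((fun F => csub_restrict (ess E) (bidual_ext lD bD F))
    : bidual A -> dual_bimodule X).
Proof.
move=> dD; set Dt := fun F => _.
have lDt : linear Dt by move=> k F G; apply: dualP.
split=> //.
  apply: (linear_continuousP lDt).2; have [K K0 DK] := bD.
  exists K => // F; apply: dual_opnorm_le => [|x]; first by rewrite mulr_ge0.
  apply: le_trans (dual_opnorm (bidual_ext lD bD F) (csub_val x)) _.
  by rewrite ler_wpM2r//; exact: bidual_ext_norm.
move=> F G; apply: dualP => x; pose v := csub_val x.
(* [hl] and [hr] are the functions of [b] whose evaluations at [F] are the terms [F.(D' G)] and
   [(D' F).G] at [x]. *)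
pose hl : dual A := slice (dual_lact_linearl (bidual_ext lD bD G))
  (dual_lact_boundedl (bidual_ext lD bD G)) v.
pose hr : dual A := slice lD bD (csub_val (ess_lact hI G x)).
transitivity (F (hl + hr)); last first.
  rewrite dual_appD -[RHS]/(@dual_lact _ _ X F (Dt G) x + @dual_ract _ _ X (Dt F) G x).
  congr (_ + _); exact: (esym (ess_ractE hI x F (bidual_ext lD bD G))).
rewrite -[LHS]/(F (bidual_lact G (slice lD bD v))); congr (F _).
apply: dualP => b.
rewrite -[RHS]/(G (slice lD bD (ract v b)) +
  (D b : dual E) (csub_val (ess_lact hI G x))).
rewrite (ess_lactE hI G x (D b)) -[ext_ract _ _ _]/(G (slice _ _ _)) -dual_appD.
rewrite -[LHS]/(G _); congr (G _); apply: dualP => a.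
by rewrite -[LHS]/((D (amul b a) : dual E) v) dD.
Qed.

Lemma connes_amenable_inner (D : A -> dual_bimodule E) :
  connes_amenable B -> derivation D -> inner D.
Proof.
move=> cB DD; have [lD cD dD] := DD; have [e eP] := connes_amenable_unit cB.
have bD := (linear_continuousP lD).1 cD.
have [|g gE] := cB X ess_wstar_bimodule _ (ess_lift_derivation lD bD dD).
  by apply: wstar_continuous_bidual => x; exists (slice lD bD (csub_val x)).
have [f fg] := csub_extend g.
(* [f] extends to [E] the functional implementing the lifted derivation on the essential part;
   subtracting the inner derivation of [f] leaves one that annihilates [A.E.A]. *)
have [|xi xiE] := derivation_inner_of_annihilating eP
  (derivation_sub_inner (f : dual_bimodule E) DD).
  move=> a b c y; pose x : X := mk_csub (@ess_gen _ _ E a b y).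
  pose z := csub_val x; have Dcz : (D c : dual E) z = f (ract z c) - f (lact c z).
    have := congr1 (fun h : dual X => h x) (gE (bidual_embed c)).
    rewrite -fg => /= Dz; transitivity (bidual_ext lD bD (bidual_embed c) z) => //.
    rewrite [LHS]Dz -[LHS]/(f (csub_val (ess_ract hI x (bidual_embed c))) -
      f (csub_val (ess_lact hI (bidual_embed c) x))).
    by rewrite ess_ractE ess_lactE.
  by rewrite -[LHS]/((D c : dual E) z - (f (ract z c) - f (lact c z))) Dcz subrr.
exists (xi + f : dual E) => a; apply: dualP => x.
have /= := congr1 (fun h : dual E => h x) (xiE a).
rewrite -[X in X = _]/((D a : dual E) x - (f (ract x a) - f (lact a x))).
rewrite -[X in _ = X]/((xi : dual E) (ract x a) - (xi : dual E) (lact a x)).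
move=> /eqP; rewrite subr_eq => /eqP ->.
rewrite -[RHS]/(((xi : dual E) (ract x a) + f (ract x a)) -
  ((xi : dual E) (lact a x) + f (lact a x))).
by rewrite opprD addrACA.
Qed.

End connes_amenable_amenable.

Theorem theorem4p4 (R : realType) (A : banachAlgType R)
    (hA : arens_regular A)
    (hI : ideal (range (@bidual_embed R A))) :
  amenable A <-> connes_amenable (bidual_dual_banach_algebra hA).
Proof.
split; first exact: amenable_connes_amenable.
by move=> cB E D; exact: connes_amenable_inner.
Qed.
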